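(* Let $R_\bullet$ be a simplicial $\mathbb{F}_2$-algebra and let $q,i$ be integers with $2\le i\le q$. For $z\in Z_qR$ put $$\delta_i(z)=\sum_{(\mu,\nu)\in V(q,i)} \bigl(s_{\nu_i}\cdots s_{\nu_1}(z)\bigr)\cdot\bigl(s_{\mu_i}\cdots s_{\mu_1}(z)\bigr)\in R_{q+i}.$$ Then this formula defines a map $\delta_i\colon Z_qR\to Z_{q+i}R$. The induced map on homotopy $\delta_i\colon \pi_qR\to\pi_{q+i}R$ is the Bousfield–Dwyer homotopy operation (as specified in the context).
   Context: **Chains and homotopy.** For a simplicial $\mathbb{F}_2$-vector space $X_\bullet$, with face maps $d_r$ and degeneracy maps $s_r$, $C_*(X)$ is the chain complex with $C_n(X)=X_n$ and differential $\partial=\sum_{r=0}^n d_r$ for $n\geq 1$ ($\partial=0$ on $C_0(X)$). The normalized chain complex is $N_qX=\bigcap_{1\le r\le q}\ker(d_r)\subseteq X_q$ with differential $d_0$; it is a quasi-isomorphic subcomplex of $C_*(X)$. Put $Z_qX=\{z\in X_q: d_rz=0 \text{ for all } 0\le r\le q\}$, the cycles of $N_qX$. The homotopy is $\pi_qX=H_q(N_*X)\cong H_q(C_*(X))$. **Index set.** For $1\le i\le q$, $V(q,i)$ is the set of pairs $(\mu,\nu)$ of strictly increasing sequences of integers $\mu_1<\dots<\mu_i$, $\nu_1<\dots<\nu_i$ such that $\{q-i,q-i+1,\dots,q+i-1\}$ is the disjoint union of $\{\mu_1,\dots,\mu_i\}$ and $\{\nu_1,\dots,\nu_i\}$, and $\mu_1=q-i$.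 **Bousfield–Dwyer operation.** For simplicial $\mathbb{F}_2$-vector spaces $V_\bullet,W_\bullet$, $V\otimes W$ is the degreewise tensor product $(V\otimes W)_n=V_n\otimes W_n$. The Eilenberg–MacLane map is $$D_{i,j}=\sum s_{\nu_j}\cdots s_{\nu_1}\otimes s_{\mu_i}\cdots s_{\mu_1}\colon V_i\otimes W_j\to V_{i+j}\otimes W_{i+j},$$ the sum being over $(i,j)$-shuffles, i.e. pairs of increasing sequences $\mu_1<\dots<\mu_i$, $\nu_1<\dots<\nu_j$ in which each element of $\{0,\dots,i+j-1\}$ occurs exactly once as either a $\mu_r$ or a $\nu_s$. Let $\phi_k\colon V_i\otimes W_j\to V_{i+j-k}\otimes W_{i+j-k}$ be the identity if $i=j=k$ and $0$ otherwise, and let $T$ denote interchange of tensor factors. A system of higher Eilenberg–MacLane maps is a family of linear maps, natural in $V_\bullet$ and $W_\bullet$, $$D^k=D^k_{i,j}\colon V_i\otimes W_j\to V_{i+j-k}\otimes W_{i+j-k}\qquad (i,j,k\ge 0,\ 2k\le i+j)$$ such that $$D^0+TD^0T=D+\phi_0,\qquad D^k+TD^kT=D^{k-1}\partial+\partial D^{k-1}+\phi_k\quad (k\ge1,\ i+j\ge 2k),$$ where $TD^kT$ is the composite $V_i\otimes W_j\to W_j\otimes V_i\to W_{i+j-k}\otimes V_{i+j-k}\to V_{i+j-k}\otimes W_{i+j-k}$ using $D^k_{j,i}$ for the pair $(W,V)$; on the source, $\partial=\partial\otimes\mathrm{id}+\mathrm{id}\otimes\partial$ is the differential of $C_*(V)\otimes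 C_*(W)$; and on the target, $\partial$ is the differential $\sum_r d_r\otimes d_r$ of $C_*(V\otimes W)$. By a theorem of Dwyer such systems exist and any two choices are equivalent up to homotopy in a strong sense. Let $\mathrm{mult}\colon R\otimes R\to R$ be the multiplication of the simplicial algebra. For $2\le i\le q$, the Bousfield–Dwyer operation $\pi_qR\to\pi_{q+i}R$ is the operation sending the class of a cycle $z\in R_q$ of $C_*(R)$ to the class of the cycle $$\Theta_i(z)=\mathrm{mult}\, D^{q-i}(z\otimes z)+\mathrm{mult}\, D^{q-i-1}(z\otimes\partial z),$$ where the second term is zero because $\partial z=0$.
   Formalization: The simplicial F_2-algebra is taken to be commutative (and unital); without commutativity the formula need not give a cycle, e.g. for q = i = 2 one has d_1 δ_2(z) = s_2z·s_1z + s_1z·s_2z. *)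

(* Defs.v *)
From HB Require Import structures.
From mathcomp Require Import all_boot all_order all_algebra.
From mathcomp Require Import boolp.

Set Implicit Arguments.
Unset Strict Implicit.
Unset Printing Implicit Defensive.

Import GRing.Theory.
Local Open Scope quotient_scope.
Local Open Scope ring_scope.

(* Tensor product of two K-modules: formal finite sums of pairs (v, w), two of
   them being identified when every bilinear map out of V x W takes the same
   value on them. [tensE], [tlift_tens] and [tensor_ext] below give the usual
   universal property. *)
Section Tensor.
Variables (K : comNzRingType) (V W : lmodType K).

Definition tsum (U : lmodType K) (b : V -> W -> U) (s : seq (V * W)) : U :=
  \sum_(p <- s) b p.1 p.2.

Definition tequiv (s t : seq (V * W)) : bool :=
  `[< forall (U : lmodType K) (b : {bilinear V -> W -> U}),
        tsum b s = tsum b t >].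

Fact tequiv_refl : reflexive tequiv.
Proof. by move=> s; apply/asboolP. Qed.

Fact tequiv_sym : symmetric tequiv.
Proof.
by move=> s t; apply/idP/idP => /asboolP st; apply/asboolP => U b; rewrite st.
Qed.

Fact tequiv_trans : transitive tequiv.
Proof.
by move=> s t u /asboolP ts /asboolP su; apply/asboolP => U b; rewrite ts su.
Qed.

Canonical tequiv_equiv := EquivRel tequiv tequiv_refl tequiv_sym tequiv_trans.

Definition tensor := {eq_quot tequiv}.
HB.instance Definition _ := Choice.on tensor.
HB.instance Definition _ := Quotient.on tensor.

Lemma tensorP (s t : seq (V * W)) :
  (forall (U : lmodType K) (b : {bilinear V -> W -> U}), tsum b s = tsum b t) ->
  \pi_tensor s = \pi_tensor t.
Proof. by move=> st; apply/eqquotP/asboolP. Qed.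

Lemma tsum_repr (U : lmodType K) (b : {bilinear V -> W -> U}) s :
  tsum b (repr (\pi_tensor s)) = tsum b s.
Proof.
have /eqquotP/asboolP : \pi_tensor (repr (\pi_tensor s)) = \pi_tensor s.
  by rewrite reprK.
exact.
Qed.

Definition tens (v : V) (w : W) : tensor := \pi_tensor [:: (v, w)].

Definition tens_zero : tensor := \pi_tensor [::].
Definition tens_add (x y : tensor) : tensor := \pi_tensor (repr x ++ repr y).
Definition tens_scale (a : K) (x : tensor) : tensor :=
  \pi_tensor [seq (a *: p.1, p.2) | p <- repr x].
Definition tens_opp (x : tensor) : tensor := tens_scale (- 1) x.

Lemma tsum_cat (U : lmodType K) (b : V -> W -> U) s t :
  tsum b (s ++ t) = tsum b s + tsum b t.
Proof. by rewrite /tsum big_cat. Qed.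

Lemma tsum_scale (U : lmodType K) (b : {bilinear V -> W -> U}) a s :
  tsum b [seq (a *: p.1, p.2) | p <- s] = a *: tsum b s.
Proof.
by rewrite /tsum big_map scaler_sumr; apply: eq_bigr => p _; rewrite linearZl_LR.
Qed.

Let tsumE := (tsum_repr, tsum_cat, tsum_scale).

Let pi_repr (x : tensor) : x = \pi_tensor (repr x). Proof. by rewrite reprK. Qed.

Fact tens_addA : associative tens_add.
Proof. by move=> x y z; apply: tensorP => U b; rewrite !tsumE addrA. Qed.

Fact tens_addC : commutative tens_add.
Proof. by move=> x y; apply: tensorP => U b; rewrite !tsumE addrC. Qed.

Fact tens_add0 : left_id tens_zero tens_add.
Proof.
move=> x; rewrite [RHS]pi_repr; apply: tensorP => U b.
by rewrite !tsumE /tsum big_nil add0r.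
Qed.

Fact tens_addN : left_inverse tens_zero tens_opp tens_add.
Proof.
move=> x; apply: tensorP => U b.
by rewrite !tsumE scaleN1r addNr /tsum big_nil.
Qed.

HB.instance Definition _ :=
  GRing.isZmodule.Build tensor tens_addA tens_addC tens_add0 tens_addN.

Fact tens_scaleA a b x : tens_scale a (tens_scale b x) = tens_scale (a * b) x.
Proof. by apply: tensorP => U f; rewrite !tsumE scalerA. Qed.

Fact tens_scale1 : left_id 1 tens_scale.
Proof.
by move=> x; rewrite [RHS]pi_repr; apply: tensorP => U b; rewrite !tsumE scale1r.
Qed.

Fact tens_scaleDr : right_distributive tens_scale +%R.
Proof. by move=> a x y; apply: tensorP => U b; rewrite !tsumE scalerDr. Qed.

Fact tens_scaleDl x : {morph tens_scale^~ x : a b / a + b}.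
Proof. by move=> a c; apply: tensorP => U b; rewrite !tsumE scalerDl. Qed.

HB.instance Definition _ := GRing.Zmodule_isLmodule.Build K tensor
  tens_scaleA tens_scale1 tens_scaleDr tens_scaleDl.

Fact tens_is_bilinear : bilinear_for *:%R *:%R tens.
Proof.
split=> [w a v v' | v a w w']; apply: tensorP => U b; rewrite !tsumE;
  by rewrite /tsum !big_seq1 ?linearPl ?linearPr.
Qed.

HB.instance Definition _ :=
  bilinear_isBilinear.Build K V W tensor *:%R *:%R tens tens_is_bilinear.

Lemma tensE (x : tensor) : x = \sum_(p <- repr x) tens p.1 p.2.
Proof.
rewrite [LHS]pi_repr; elim: (repr x) => [|[v w] s IHs]; first by rewrite big_nil.
rewrite big_cons -IHs /=; apply: tensorP => U b.
by rewrite !tsumE -tsum_cat.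
Qed.

Definition tlift (U : lmodType K) (b : {bilinear V -> W -> U}) (x : tensor) : U :=
  tsum b (repr x).

Fact tlift_is_linear (U : lmodType K) (b : {bilinear V -> W -> U}) :
  linear (tlift b).
Proof. by move=> a x y; rewrite /tlift !tsumE. Qed.

HB.instance Definition _ (U : lmodType K) (b : {bilinear V -> W -> U}) :=
  GRing.isLinear.Build K tensor U *:%R (tlift b) (tlift_is_linear b).

Lemma tlift_tens (U : lmodType K) (b : {bilinear V -> W -> U}) v w :
  tlift b (tens v w) = b v w.
Proof. by rewrite /tlift tsumE /tsum big_seq1. Qed.

Lemma tensor_ext (U : lmodType K) (f g : {linear tensor -> U}) :
  (forall v w, f (tens v w) = g (tens v w)) -> f =1 g.
Proof.
by move=> fg x; rewrite (tensE x) !linear_sum; apply: eq_bigr => p _; apply: fg.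
Qed.

End Tensor.

Section TensorMaps.
Variable K : comNzRingType.

Section Swap.
Variables V W : lmodType K.

Definition tens_rev (v : V) (w : W) : tensor W V := tens w v.

Fact tens_rev_is_bilinear : bilinear_for *:%R *:%R tens_rev.
Proof.
by split=> [w a v v' | v a w w']; rewrite /tens_rev ?linearPl ?linearPr.
Qed.

HB.instance Definition _ := bilinear_isBilinear.Build K V W (tensor W V)
  *:%R *:%R tens_rev tens_rev_is_bilinear.

Definition tswap : tensor V W -> tensor W V := tlift tens_rev.

HB.instance Definition _ := GRing.Linear.on tswap.

Lemma tswap_tens v w : tswap (tens v w) = tens w v.
Proof. exact: tlift_tens. Qed.

End Swap.

Section Tmap.
Variables V V' W W' : lmodType K.
Variables (f : {linear V -> V'}) (g : {linear W -> W'}).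

Definition tens_comp (v : V) (w : W) : tensor V' W' := tens (f v) (g w).

Fact tens_comp_is_bilinear : bilinear_for *:%R *:%R tens_comp.
Proof.
by split=> [w a v v' | v a w w'];
   rewrite /tens_comp linearP ?linearPl ?linearPr.
Qed.

HB.instance Definition _ := bilinear_isBilinear.Build K V W (tensor V' W')
  *:%R *:%R tens_comp tens_comp_is_bilinear.

Definition tmap : tensor V W -> tensor V' W' := tlift tens_comp.

HB.instance Definition _ := GRing.Linear.on tmap.

Lemma tmap_tens v w : tmap (tens v w) = tens (f v) (g w).
Proof. exact: tlift_tens. Qed.

End Tmap.

Lemma tmap_comp (V V' V'' W W' W'' : lmodType K)
    (f : {linear V -> V'}) (f' : {linear V' -> V''})
    (g : {linear W -> W'}) (g' : {linear W' -> W''}) x :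
  tmap f' g' (tmap f g x) = tmap (f' \o f) (g' \o g) x.
Proof.
move: x; apply: (tensor_ext (f := tmap f' g' \o tmap f g)) => v w /=.
by rewrite !tmap_tens.
Qed.

Lemma eq_tmap (V V' W W' : lmodType K)
    (f f' : {linear V -> V'}) (g g' : {linear W -> W'}) :
  f =1 f' -> g =1 g' -> tmap f g =1 tmap f' g'.
Proof.
move=> ff gg; apply: (tensor_ext (f := tmap f g) (g := tmap f' g')) => v w.
by rewrite /= !tmap_tens ff gg.
Qed.

Lemma tmap_id (V W : lmodType K) (x : tensor V W) : tmap idfun idfun x = x.
Proof.
move: x; apply: (tensor_ext (f := tmap idfun idfun) (g := idfun)) => v w /=.
by rewrite tmap_tens.
Qed.

End TensorMaps.

(* Faces and degeneracies are indexed by all of nat to avoid ordinal casts, but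
   d n r : X n.+1 -> X n is meaningful only for r <= n.+1 and
   s n r : X n -> X n.+1 only for r <= n: nothing is required of the others. *)
Definition simplicial_identities (X : nat -> Type)
    (d : forall n, nat -> X n.+1 -> X n)
    (s : forall n, nat -> X n -> X n.+1) : Prop :=
  [/\ forall n i j (x : X n.+2), (i < j <= n.+2)%N ->
        d n i (d n.+1 j x) = d n j.-1 (d n.+1 i x),
      forall n i j (x : X n.+1), (i < j <= n.+1)%N ->
        d n.+1 i (s n.+1 j x) = s n j.-1 (d n i x),
      forall n j (x : X n), (j <= n)%N ->
        d n j (s n j x) = x /\ d n j.+1 (s n j x) = x,
      forall n i j (x : X n.+1), (j.+1 < i <= n.+2)%N ->
        d n.+1 i (s n.+1 j x) = s n j (d n i.-1 x)
    & forall n i j (x : X n), (i <= j <= n)%N ->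
        s n.+1 i (s n j x) = s n.+1 j.+1 (s n i x) ].

Record simplVect := SimplVect {
  sv_ob :> nat -> lmodType 'F_2;
  face : forall n, nat -> {linear sv_ob n.+1 -> sv_ob n};
  degen : forall n, nat -> {linear sv_ob n -> sv_ob n.+1};
  sv_identities : simplicial_identities
    (fun n r => face n r : sv_ob n.+1 -> sv_ob n)
    (fun n r => degen n r : sv_ob n -> sv_ob n.+1)
}.

Record simplMap (V W : simplVect) := SimplMap {
  sm_map :> forall n, {linear V n -> W n};
  sm_face : forall n r (x : V n.+1), (r <= n.+1)%N ->
    sm_map n (face V n r x) = face W n r (sm_map n.+1 x);
  sm_degen : forall n r (x : V n), (r <= n)%N ->
    sm_map n.+1 (degen V n r x) = degen W n r (sm_map n x)
}.

(* Simplicial commutative unital F_2-algebras. The algebra structure of each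
   degree is spelled out, as comAlgType would exclude the zero algebra. *)
Record simplAlg := SimplAlg {
  sa_vect :> simplVect;
  amul : forall n, {bilinear sa_vect n -> sa_vect n -> sa_vect n};
  aone : forall n, sa_vect n;
  amulA : forall n, associative (amul n);
  amulC : forall n, commutative (amul n);
  amul1 : forall n, left_id (aone n) (amul n);
  face_amul : forall n r x y, (r <= n.+1)%N ->
    face sa_vect n r (amul n.+1 x y) =
    amul n (face sa_vect n r x) (face sa_vect n r y);
  face_aone : forall n r, (r <= n.+1)%N ->
    face sa_vect n r (aone n.+1) = aone n;
  degen_amul : forall n r x y, (r <= n)%N ->
    degen sa_vect n r (amul n x y) =
    amul n.+1 (degen sa_vect n r x) (degen sa_vect n r y);
  degen_aone : forall n r, (r <= n)%N ->
    degen sa_vect n r (aone n) = aone n.+1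
}.

Arguments amul {s n}.

Definition mult (R : simplAlg) n : tensor (R n) (R n) -> R n := tlift amul.

HB.instance Definition _ (R : simplAlg) n := GRing.Linear.on (@mult R n).

Lemma mult_tens (R : simplAlg) n (x y : R n) : mult (tens x y) = amul x y.
Proof. exact: tlift_tens. Qed.

Section TensorSimplicial.
Variables V W : simplVect.

Let tface n r := tmap (face V n r) (face W n r).
Let tdegen n r := tmap (degen V n r) (degen W n r).

Fact tensor_identities : simplicial_identities tface tdegen.
Proof.
have [V1 V2 V3 V4 V5] := sv_identities V.
have [W1 W2 W3 W4 W5] := sv_identities W.
split=> [n i j x ij | n i j x ij | n j x jn | n i j x ij | n i j x ij];
  rewrite /tface /tdegen !tmap_comp.
- by apply: eq_tmap => y; [apply: V1 | apply: W1].
- by apply: eq_tmap => y; [apply: V2 | apply: W2].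
- split; rewrite -[RHS]tmap_id; apply: eq_tmap => y /=.
  + by have [] := V3 _ _ y jn.
  + by have [] := W3 _ _ y jn.
  + by have [] := V3 _ _ y jn.
  + by have [] := W3 _ _ y jn.
- by apply: eq_tmap => y; [apply: V4 | apply: W4].
- by apply: eq_tmap => y; [apply: V5 | apply: W5].
Qed.

Definition stensor : simplVect :=
  @SimplVect (fun n => tensor (V n) (W n) : lmodType 'F_2)
    (fun n r => tmap (face V n r) (face W n r))
    (fun n r => tmap (degen V n r) (degen W n r))
    tensor_identities.

End TensorSimplicial.

Section Chains.
Variable X : simplVect.

(* d_r on X_q, with value 0 when q = 0. *)
Definition dface q (r : nat) : {linear X q -> X q.-1} :=
  match q return {linear X q -> X q.-1} with
  | 0 => \0 : {linear X 0%N -> X 0%N}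
  | n.+1 => face X n r
  end.

Definition bdry q (x : X q) : X q.-1 := \sum_(r < q.+1) dface q r x.

Fact bdry_is_linear q : linear (@bdry q).
Proof.
move=> a x y; rewrite /bdry scaler_sumr -big_split /=.
by apply: eq_bigr => r _; rewrite linearP.
Qed.

HB.instance Definition _ q :=
  GRing.isLinear.Build 'F_2 (X q) (X q.-1) *:%R (@bdry q) (@bdry_is_linear q).

Definition normalized q (x : X q) : Prop :=
  forall r, (0 < r <= q)%N -> dface q r x = 0.

Definition is_norm_cycle q (x : X q) : Prop :=
  forall r, (r <= q)%N -> dface q r x = 0.

Definition norm_boundary q : {pred X q} :=
  fun x => `[< exists2 y : X q.+1, normalized y & dface q.+1 0 y = x >].

Definition chain_boundary q : {pred X q} :=
  fun x => `[< exists y : X q.+1, bdry y = x >].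

Fact norm_boundary_zmod_closed q : zmod_closed (@norm_boundary q).
Proof.
split=> [|x y].
  by apply/asboolP; exists 0; [move=> r _; rewrite linear0 | rewrite linear0].
move=> /asboolP[u Nu ux] /asboolP[v Nv vy]; apply/asboolP.
exists (u - v); last by rewrite linearB ux vy.
by move=> r hr; rewrite linearB Nu // Nv // subrr.
Qed.

HB.instance Definition _ q :=
  GRing.isZmodClosed.Build (X q) (@norm_boundary q) (@norm_boundary_zmod_closed q).

Fact chain_boundary_zmod_closed q : zmod_closed (@chain_boundary q).
Proof.
split=> [|x y]; first by apply/asboolP; exists 0; rewrite linear0.
move=> /asboolP[u ux] /asboolP[v vy]; apply/asboolP.
by exists (u - v); rewrite linearB /= ux vy.
Qed.

HB.instance Definition _ q := GRing.isZmodClosed.Build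
  (X q) (@chain_boundary q) (@chain_boundary_zmod_closed q).

End Chains.

Arguments dface {X q} r.
Arguments bdry {X q} x.
Arguments norm_boundary X q : clear implicits.
Arguments chain_boundary X q : clear implicits.

(* Underlying set of the homology group (elements satisfying Z) / B. *)
Section Homology.
Variables (U : zmodType) (Z : U -> Prop) (B : zmodClosed U).

Definition cycle_type : Type := {x : U | `[< Z x >]}.
HB.instance Definition _ := Choice.on cycle_type.
HB.instance Definition _ := SubType.on cycle_type.

Definition homologous (x y : cycle_type) : bool := val x - val y \in B.

Fact homologous_refl : reflexive homologous.
Proof. by move=> x; rewrite /homologous subrr rpred0. Qed.

Fact homologous_sym : symmetric homologous.
Proof. by move=> x y; rewrite /homologous -opprB rpredN. Qed.

Fact homologous_trans : transitive homologous.
Proof.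
by move=> y x z xy yz; rewrite /homologous -(subrKA (val y)) rpredD.
Qed.

Canonical homologous_equiv :=
  EquivRel homologous homologous_refl homologous_sym homologous_trans.

Definition homology := {eq_quot homologous}.
HB.instance Definition _ := Choice.on homology.
HB.instance Definition _ := Quotient.on homology.

Definition hclass (z : cycle_type) : homology := \pi_homology z.

Lemma hclassP x y : reflect (hclass x = hclass y) (val x - val y \in B).
Proof. by apply: (iffP idP) => [xy | /eqquotP //]; apply/eqquotP. Qed.

End Homology.

Section HomotopyGroups.
Variables (X : simplVect) (q : nat).

(* Z_q X and pi_q X = H_q(N_* X) *)
Definition Zn : Type := cycle_type (@is_norm_cycle X q).
Definition homotopy : Type := homology (@is_norm_cycle X q) (norm_boundary X q).

(* Cycles of C_q(X) and H_q(C_* X) *)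
Definition chain_cycle : Type := cycle_type (fun x : X q => bdry x = 0).
Definition chain_homology : Type :=
  homology (fun x : X q => bdry x = 0) (chain_boundary X q).

Fact norm_cycle_bdry (z : Zn) : `[< bdry (val z) = 0 >].
Proof.
apply/asboolP; have /asboolP Zz := valP z.
by rewrite /bdry big1 // => r _; rewrite Zz // -ltnS.
Qed.

Definition chain_cycle_of (z : Zn) : chain_cycle :=
  exist (fun x : X q => `[< bdry x = 0 >]) (val z) (norm_cycle_bdry z).

(* The map H_q(N_* X) -> H_q(C_* X) induced by the inclusion of N_* X. *)
Definition homotopy_to_chain (x : homotopy) : chain_homology :=
  hclass _ (chain_cycle_of (repr x)).

Lemma homotopy_to_chain_class (z : Zn) :
  homotopy_to_chain (hclass _ z) = hclass _ (chain_cycle_of z).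
Proof.
have /hclassP/asboolP[y Ny dy] :
    hclass (norm_boundary X q) (repr (hclass (norm_boundary X q) z)) =
    hclass (norm_boundary X q) z by rewrite /hclass reprK.
apply/hclassP/asboolP; exists y.
rewrite /bdry big_ord_recl big1 /= ?addr0 // => r _.
by rewrite (Ny (bump 0 r)) //= ltn_ord.
Qed.

End HomotopyGroups.

(* Transport of x from degree m to degree n: the identity when m = n (see
   [regrade_id]) and 0 otherwise. *)
Section Regrade.
Variables (X : simplVect) (n m : nat).

Definition regrade (x : X m) : X n :=
  if m =P n is ReflectT e then ecast k (X k) e x else 0.

Fact regrade_is_linear : linear regrade.
Proof.
move=> a x y; rewrite /regrade; case: eqP => [e|_].
  by case: n / e.
by rewrite scaler0 addr0.
Qed.

HB.instance Definition _ :=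
  GRing.isLinear.Build 'F_2 (X m) (X n) *:%R regrade regrade_is_linear.

End Regrade.

Arguments regrade {X} n {m} x.

Lemma regrade_id (X : simplVect) n (x : X n) : regrade n x = x.
Proof. by rewrite /regrade; case: eqP => // e; rewrite eq_axiomK. Qed.

(* degens nu i x = s_{nu_i} ... s_{nu_1} x, where nu = [:: nu_1; nu_2; ...] *)
Section Degens.
Variables (X : simplVect) (nu : seq nat) (m : nat).

Fixpoint degens (i : nat) (x : X m) : X (i + m)%N :=
  if i is i'.+1 then degen X (i' + m) (nth 0%N nu i') (degens i' x) else x.

Fact degens_is_linear i : linear (degens i).
Proof. by move=> a x y; elim: i => //= i ->; rewrite linearP. Qed.

HB.instance Definition _ i := GRing.isLinear.Build
  'F_2 (X m) (X (i + m)%N) *:%R (degens i) (@degens_is_linear i).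

End Degens.

Definition ordvals (N l : nat) (t : l.-tuple 'I_N) : seq nat :=
  [seq val r | r <- t].

Definition shuffle (i j : nat)
    (mu : i.-tuple 'I_(i + j)) (nu : j.-tuple 'I_(i + j)) : bool :=
  [&& sorted ltn (ordvals mu), sorted ltn (ordvals nu)
    & [forall r, (r \in mu) (+) (r \in nu)]].

Definition Vset (q i : nat) (mu nu : i.-tuple 'I_(q + i)) : bool :=
  [&& sorted ltn (ordvals mu), sorted ltn (ordvals nu), [disjoint mu & nu],
      [set r in mu] :|: [set r in nu] == [set r : 'I_(q + i) | (q - i <= r)%N]
    & nth 0%N (ordvals mu) 0 == (q - i)%N].

Section EilenbergMacLane.
Variables V W : simplVect.

(* The map D_{i,j}; the target degree n is meant to be i + j. *)
Definition EM (i j n : nat) (x : tensor (V i) (W j)) : tensor (V n) (W n) :=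
  \sum_(p : i.-tuple 'I_(i + j) * j.-tuple 'I_(i + j) | shuffle p.1 p.2)
    tmap (regrade n \o degens (ordvals p.2) j)
         (regrade n \o degens (ordvals p.1) i) x.

Definition phi (k i j n : nat) (x : tensor (V i) (W j)) : tensor (V n) (W n) :=
  if (i == k) && (j == k) then tmap (regrade n) (regrade n) x else 0.

End EilenbergMacLane.

(* hem k i j n is D^k_{i,j} with the target degree n = i + j - k made explicit:
   it is meaningful only if i + j = k + n and k <= n (that is, 2k <= i + j), and
   nothing is required of it outside this range. *)
Record higherEM := HigherEM {
  hem : forall (V W : simplVect) (k i j n : nat),
    {linear tensor (V i) (W j) -> tensor (V n) (W n)};
  hem_natural : forall (V V' W W' : simplVect)
      (f : simplMap V V') (g : simplMap W W') (k i j n : nat)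
      (x : tensor (V i) (W j)),
    (i + j = k + n)%N -> (k <= n)%N ->
    hem V' W' k i j n (tmap (f i) (g j) x) =
    tmap (f n) (g n) (hem V W k i j n x);
  hem0 : forall (V W : simplVect) (i j n : nat) (x : tensor (V i) (W j)),
    (i + j = n)%N ->
    hem V W 0 i j n x + tswap (hem W V 0 j i n (tswap x)) =
    EM n x + phi 0 n x;
  hemS : forall (V W : simplVect) (k i j n : nat) (x : tensor (V i) (W j)),
    (i + j = k.+1 + n)%N -> (k.+1 <= n)%N ->
    hem V W k.+1 i j n x + tswap (hem W V k.+1 j i n (tswap x)) =
    hem V W k i.-1 j n (tmap bdry idfun x) +
    hem V W k i j.-1 n (tmap idfun bdry x) +
    bdry (hem V W k i j n.+1 x : stensor V W n.+1) +
    phi k.+1 n x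
}.

Section Operations.
Variables (R : simplAlg) (q i : nat).

Definition delta (z : R q) : R (i + q)%N :=
  \sum_(p : i.-tuple 'I_(q + i) * i.-tuple 'I_(q + i) | Vset p.1 p.2)
    amul (degens (ordvals p.2) i z) (degens (ordvals p.1) i z).

(* When q = i the second summand has no meaning as D^{-1}(z (x) bdry z), but it
   is then a value of a linear map at 0, as for any other cycle z. *)
Definition Theta (D : higherEM) (z : R q) : R (i + q)%N :=
  mult (hem D R R (q - i) q q (i + q) (tens z z)) +
  mult (hem D R R (q - i).-1 q q.-1 (i + q) (tens z (bdry z))).

Definition is_BousfieldDwyer (D : higherEM)
    (theta : chain_homology R q -> chain_homology R (i + q)) : Prop :=
  forall z : chain_cycle R q,
    exists2 t : chain_cycle R (i + q),
      val t = Theta D (val z) & theta (hclass _ z) = hclass _ t.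

End Operations.

(* Main.v *)
(* A class z in Z_q R is the image of the fundamental class iota of K(F_2, q), and
   K(F_2, q) is the weight q part of the bar construction of F_2[t]/(t^2), so that
   chains of K(F_2, q) (x) K(F_2, q) are words in E, N, D = EN and a unit. There
   delta_i becomes the sum v_k (k = q - i) of the words D^k E u with u in {E, N}^*,
   whose faces are computed letter by letter: all of them vanish but one, which is
   v_(k+1) + T v_(k+1). Hence v_k and u_k = D^k(iota (x) iota) satisfy the same
   recursion, and w_k = u_k + v_k satisfies d w_k = w_(k+1) + T w_(k+1). As the
   normalized words of weight (q, q) have no homology below length 2q and only
   symmetric cycles in length 2q, downward induction on k gives
   w_k = e + T e + d f up to degenerate words, and multiplying in the commutative
   ring R kills e + T e. What is left is a degenerate cycle, hence a boundary.
   The same calculus of words bounds delta_i(z + d_0 y) - delta_i(z) explicitly. *)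
Require Import Defs.
From HB Require Import structures.
From mathcomp Require Import all_boot all_order all_algebra.
From mathcomp Require Import boolp zify.

Set Implicit Arguments.
Unset Strict Implicit.
Unset Printing Implicit Defensive.

Import GRing.Theory.
Local Open Scope ring_scope.

(** * Sums over words and bar constructions *)

(** A system [D] is known only through naturality and its recursion, so nothing can be computed with
    it in [R] itself; the sphere supplies an explicit complex, and naturality carries the result
    back. The corrected difference w_k + e + T e + d f vanishes only on words without unit letters,
    and it need not be a cycle in the sphere. It becomes a cycle after multiplication in [R], which
    is why degenerate cycles are treated in a general simplicial vector space and the result is
    applied in [R]. The bound 2 <= i has one source. The word D^(k+1) is fixed by T, so it occurs in
    the face of v_k but not in v_(k+1) + T v_(k+1). In weight (q, q) it has length q and matters
    only when k + 1 = q, that is i = 1, where it would leave the face z z. In the recursion for u_k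
    the term phi contributes the same word, so the two recursions agree there as well. *)

Lemma F2_addrr (V : lmodType 'F_2) (x : V) : x + x = 0.
Proof.
by rewrite -mulr2n -scaler_nat (_ : 2%:R = 0 :> 'F_2) ?scale0r //; apply: val_inj.
Qed.

Lemma F2_oppr (V : lmodType 'F_2) (x : V) : - x = x.
Proof. by apply/eqP; rewrite eq_sym -subr_eq0 opprK F2_addrr. Qed.

Lemma F2_addrK (V : lmodType 'F_2) (x y : V) : x + y + y = x.
Proof. by rewrite -addrA F2_addrr addr0. Qed.

Lemma F2_addr_eq0 (V : lmodType 'F_2) (x y : V) : x + y = 0 -> x = y.
Proof. by move/eqP; rewrite addr_eq0 F2_oppr => /eqP. Qed.

Lemma addFF (x : 'F_2) : x + x = 0.
Proof. by apply: val_inj; case: x => [[|[|]]]. Qed.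

Lemma addFK (x y : 'F_2) : x + y + y = x.
Proof. by rewrite -addrA addFF addr0. Qed.

Lemma addF_eq (x y : 'F_2) : x + y = 0 -> x = y.
Proof. by move=> xy; rewrite -[LHS](addFK x y) xy add0r. Qed.

Section WordSums.
Variable L : finType.

(** Words are plain lists and their length is an argument of the sum, so operators that recurse on
    letters need no dependent types. *)
Fixpoint wsum (V : zmodType) n (F : seq L -> V) : V :=
  if n is m.+1 then \sum_l wsum m (fun w => F (l :: w)) else F [::].

Variable V : zmodType.
Implicit Types (F G : seq L -> V) (n : nat).

Lemma eq_wsum n F G :
  (forall w, size w = n -> F w = G w) -> wsum n F = wsum n G.
Proof.
elim: n F G => [|n IH] F G FG /=; first exact: FG.
by apply: eq_bigr => l _; apply: IH => w sw; apply: FG; rewrite /= sw.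
Qed.

Lemma wsum0 n : wsum n (fun _ => 0 : V) = 0.
Proof. by elim: n => //= n IH; rewrite big1. Qed.

Lemma wsumD n F G : wsum n (fun w => F w + G w) = wsum n F + wsum n G.
Proof.
elim: n F G => //= n IH F G; rewrite -big_split /=.
by apply: eq_bigr => l _; rewrite IH.
Qed.

Lemma wsum_sum (I : Type) (r : seq I) (P : pred I) n (F : I -> seq L -> V) :
  wsum n (fun w => \sum_(i <- r | P i) F i w) =
  \sum_(i <- r | P i) wsum n (F i).
Proof.
elim: n F => //= n IH F.
by rewrite exchange_big /=; apply: eq_bigr => l _; rewrite IH.
Qed.

Lemma wsum_map n (h : L -> L) F :
  involutive h -> wsum n (fun w => F (map h w)) = wsum n F.
Proof.
move=> hK; elim: n F => //= n IH F.
rewrite [RHS](reindex_inj (inv_inj hK)) /=; apply: eq_bigr => l _.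
exact: (IH (fun w => F (h l :: w))).
Qed.

Lemma wsum_tuple n F : wsum n F = \sum_(t : n.-tuple L) F t.
Proof.
elim: n F => [|n IH] F /=.
  rewrite (big_pred1 [tuple]) // => t; apply/esym/eqP/val_inj.
  by rewrite /= (size0nil (size_tuple t)).
under eq_bigr do rewrite IH.
rewrite pair_big /= (reindex (fun p : L * n.-tuple L => [tuple of p.1 :: p.2])) /=.
  by apply: eq_bigr.
exists (fun t : n.+1.-tuple L => (thead t, [tuple of behead t])) => [[l t] _|t _].
  by congr pair; apply: val_inj.
by rewrite [RHS]tuple_eta.
Qed.

End WordSums.

Lemma raddf_wsum (L : finType) (U V : zmodType) (f : {additive U -> V}) n
    (F : seq L -> U) : f (wsum n F) = wsum n (fun w => f (F w)).
Proof.
by elim: n F => //= n IH F; rewrite raddf_sum; apply: eq_bigr => l _; rewrite IH.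
Qed.

Lemma wsumZ (L : finType) (K : pzRingType) (V : lmodType K) k n (F : seq L -> V) :
  k *: wsum n F = wsum n (fun w => k *: F w).
Proof.
by elim: n F => //= n IH F; rewrite scaler_sumr; apply: eq_bigr => l _; rewrite IH.
Qed.

Lemma wsum_unzip (V : zmodType) n (F : seq bool -> seq bool -> V) :
  wsum n (fun w : seq (bool * bool) => F (unzip1 w) (unzip2 w)) =
  wsum n (fun x => wsum n (F x)).
Proof.
elim: n F => //= n IH F; rewrite -(pair_bigA _ (fun a b => wsum n (fun w : seq (bool * bool) =>
  F (a :: unzip1 w) (b :: unzip2 w)))) /=.
apply: eq_bigr => a _; rewrite (wsum_sum _ xpredT); apply: eq_bigr => b _ /=.
exact: (IH (fun x y => F (a :: x) (b :: y))).
Qed.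

(* A simplicial operator acts on words by merging adjacent letters (faces) and
   inserting units (degeneracies), as in the bar construction of an augmented
   algebra with a basis closed under multiplication up to zero; [None] stands for
   the zero product, and the outer faces kill every letter but the unit. *)
Section BarWords.
Variables (L : finType) (one : L) (mul : L -> L -> option L).

Fixpoint wmerge r (w : seq L) : option (seq L) :=
  match r, w with
  | _, [::] => None
  | 0, l :: v => if l == one then Some v else None
  | 1, [:: l] => if l == one then Some [::] else None
  | 1, l :: l' :: v => omap (cons^~ v) (mul l l')
  | r'.+1, l :: v => omap (cons l) (wmerge r' v)
  end.

Fixpoint winsert r (w : seq L) : seq L :=
  match r, w with
  | r'.+1, l :: v => l :: winsert r' v
  | _, _ => one :: w
  end.

(* The transposes of [wmerge] and [winsert] on functions of words. *)
Fixpoint wface r (c : seq L -> 'F_2) (w : seq L) : 'F_2 :=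
  match r, w with
  | 0, _ => c (one :: w)
  | _, [::] => c [:: one]
  | 1, l :: v => \sum_(p | mul p.1 p.2 == Some l) c (p.1 :: p.2 :: v)
  | r'.+1, l :: v => wface r' (fun u => c (l :: u)) v
  end.

Fixpoint wdegen r (c : seq L -> 'F_2) (w : seq L) : 'F_2 :=
  match r, w with
  | _, [::] => 0
  | 0, l :: v => if l == one then c v else 0
  | r'.+1, l :: v => wdegen r' (fun u => c (l :: u)) v
  end.

Lemma wface0E c w : wface 0 c w = c (one :: w). Proof. by []. Qed.

Lemma wfaceS_nil r c : wface r.+1 c [::] = c [:: one]. Proof. by case: r. Qed.

Lemma wface1_cons c l v : wface 1 c (l :: v) =
  \sum_(p | mul p.1 p.2 == Some l) c (p.1 :: p.2 :: v).
Proof. by []. Qed.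

Lemma wfaceSS_cons r c l v :
  wface r.+2 c (l :: v) = wface r.+1 (fun u => c (l :: u)) v.
Proof. by []. Qed.

Definition wfaceE := (wface0E, wfaceS_nil, wface1_cons, wfaceSS_cons).

Lemma wdegen_nil r c : wdegen r c [::] = 0. Proof. by case: r. Qed.

Lemma wdegen0_cons c l v : wdegen 0 c (l :: v) = if l == one then c v else 0.
Proof. by []. Qed.

Lemma wdegenS_cons r c l v :
  wdegen r.+1 c (l :: v) = wdegen r (fun u => c (l :: u)) v.
Proof. by []. Qed.

Definition wdegenE := (wdegen_nil, wdegen0_cons, wdegenS_cons).

Lemma wmerge_nil r : wmerge r [::] = None. Proof. by case: r => [|[]]. Qed.

Lemma wmerge0_cons l v : wmerge 0 (l :: v) = if l == one then Some v else None.
Proof. by []. Qed.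

Lemma wmerge1_seq1 l : wmerge 1 [:: l] = if l == one then Some [::] else None.
Proof. by []. Qed.

Lemma wmerge1_cons2 l l' v : wmerge 1 (l :: l' :: v) = omap (cons^~ v) (mul l l').
Proof. by []. Qed.

Lemma wmergeSS_cons r l v : wmerge r.+2 (l :: v) = omap (cons l) (wmerge r.+1 v).
Proof. by case: v. Qed.

Definition wmergeE :=
  (wmerge_nil, wmerge0_cons, wmerge1_seq1, wmerge1_cons2, wmergeSS_cons).

Arguments wface : simpl never.
Arguments wdegen : simpl never.
Arguments wmerge : simpl never.

Lemma eq_wface r c c' w :
  (forall v, size v = (size w).+1 -> c v = c' v) -> wface r c w = wface r c' w.
Proof.
elim: r c c' w => [|[|r] IH] c c' [|l w] cc'; rewrite !wfaceE; do ?exact: cc'.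
- by apply: eq_bigr => p _; apply: cc'.
- by apply: IH => v sv; apply: cc'; rewrite /= sv.
Qed.

Lemma eq_wdegen r c c' w :
  (forall v, (size v).+1 = size w -> c v = c' v) -> wdegen r c w = wdegen r c' w.
Proof.
elim: r c c' w => [|r IH] c c' [|l w] cc'; rewrite !wdegenE //.
  by case: ifP => // _; apply: cc'.
by apply: IH => v sv; apply: cc'; rewrite /= sv.
Qed.

Lemma wface0 r w : wface r (fun _ => 0) w = 0.
Proof. by elim: r w => [|[|r] IH] [|l w]; rewrite !wfaceE // big1. Qed.

Lemma wfaceD r c c' w : wface r (fun v => c v + c' v) w = wface r c w + wface r c' w.
Proof.
elim: r c c' w => [|[|r] IH] c c' [|l w]; rewrite !wfaceE //.
by rewrite big_split.
Qed.

Lemma wfaceZ r a c w : wface r (fun v => a * c v) w = a * wface r c w.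
Proof.
elim: r c w => [|[|r] IH] c [|l w]; rewrite !wfaceE //.
by rewrite mulr_sumr.
Qed.

Lemma wdegen0 r w : wdegen r (fun _ => 0) w = 0.
Proof. by elim: r w => [|r IH] [|l w]; rewrite !wdegenE // if_same. Qed.

Lemma wdegenD r c c' w :
  wdegen r (fun v => c v + c' v) w = wdegen r c w + wdegen r c' w.
Proof.
elim: r c c' w => [|r IH] c c' [|l w]; rewrite !wdegenE ?addr0 //.
by case: ifP; rewrite ?addr0.
Qed.

Lemma wdegenZ r a c w : wdegen r (fun v => a * c v) w = a * wdegen r c w.
Proof.
elim: r c w => [|r IH] c [|l w]; rewrite !wdegenE ?mulr0 //.
by case: ifP; rewrite ?mulr0.
Qed.

Variable V : lmodType 'F_2.

(** This adjunction reduces commutation with a face to single words: a map given on words commutes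
    with it as soon as it does so word by word. *)
Lemma wsum_wface r n c (F : seq L -> V) : (r <= n.+1)%N ->
  wsum n (fun w => wface r c w *: F w) =
  wsum n.+1 (fun w => c w *: oapp F 0 (wmerge r w)).
Proof.
elim: r n c F => [|[|r] IH] n c F rn.
- rewrite [RHS]/= (bigD1 one) //= big1 ?addr0 => [|l /negPf l1].
    by apply: eq_wsum => w _; rewrite wfaceE wmergeE eqxx.
  by rewrite -[RHS](wsum0 L V n); apply: eq_wsum => w _; rewrite wmergeE l1 scaler0.
- case: n {rn} => [|n] /=.
    rewrite (bigD1 one) //= big1 ?addr0 => [|l /negPf l1].
      by rewrite wfaceE wmergeE eqxx.
    by rewrite wmergeE l1 scaler0.
  under eq_bigr => l _.
    under eq_wsum do rewrite scaler_suml.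
    rewrite (wsum_sum _ (fun p : L * L => mul p.1 p.2 == Some l) n
              (fun p w => c (p.1 :: p.2 :: w) *: F (l :: w))).
    over.
  rewrite (exchange_big_dep xpredT) //= pair_bigA /=; apply: eq_bigr => p _.
  under [RHS]eq_wsum do rewrite wmergeE.
  case: (mul p.1 p.2) => [l|] /=.
    by rewrite (big_pred1 l) // => l'; rewrite eq_sym; apply/eqP/eqP => [[]|->].
  by rewrite big_pred0 // -[LHS](wsum0 L V n); apply: eq_wsum => w _; rewrite scaler0.
- case: n rn => // n rn; rewrite [LHS]/= [RHS]/=.
  apply: eq_bigr => l _.
  rewrite (IH n (fun u => c (l :: u)) (fun w => F (l :: w))) //=.
  apply: eq_bigr => l' _.
  by apply: eq_wsum => w _; rewrite wmergeE; case: wmerge.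
Qed.

Lemma wsum_wdegen r n (c : seq L -> 'F_2) (F : seq L -> V) : (r <= n)%N ->
  wsum n.+1 (fun x => wdegen r c x *: F x) =
  wsum n (fun x => c x *: F (winsert r x)).
Proof.
elim: r n c F => [|r IH] n c F rn.
  rewrite [LHS]/= (bigD1 one) //= big1 ?addr0 => [|l /negPf l1].
    by apply: eq_wsum => w _; rewrite wdegenE eqxx; case: w.
  by rewrite -[RHS](wsum0 L V n); apply: eq_wsum => w _; rewrite wdegenE l1 scale0r.
case: n rn => // n rn; rewrite [LHS]/= [RHS]/=.
by apply: eq_bigr => b _; apply: (IH n (fun u => c (b :: u)) (fun u => F (b :: u))).
Qed.

End BarWords.

Arguments wface : simpl never.
Arguments wdegen : simpl never.
Arguments wmerge : simpl never.
Arguments eq_wface {L one mul r c c' w} _.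
Arguments eq_wdegen {L one r c c' w} _.

(** * The universal example *)

(** The basis of F_2[t]/(t^2): [false] is 1, [true] is t, and [None] is t^2 = 0. *)
Definition bmul (a b : bool) : option bool := if a && b then None else Some (a || b).

Notation bface := (wface false bmul).
Notation bdegen := (wdegen false).
Notation bmerge := (wmerge false bmul).
Notation binsert := (winsert false).

Lemma bface1_true c v :
  bface 1 c (true :: v) = c [:: true, false & v] + c [:: false, true & v].
Proof.
rewrite wface1_cons big_mkcond -(pair_bigA _ (fun a b =>
  if bmul a b == Some true then c [:: a, b & v] else 0)) /= !big_bool /=.
by rewrite add0r addr0.
Qed.

Lemma bface1_false c v : bface 1 c (false :: v) = c [:: false, false & v].
Proof.
rewrite wface1_cons big_mkcond -(pair_bigA _ (fun a b =>
  if bmul a b == Some false then c [:: a, b & v] else 0)) /= !big_bool /=.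
by rewrite !add0r.
Qed.

Definition bE := (wface0E, wfaceS_nil, bface1_true, bface1_false, wfaceSS_cons, wdegenE).

Lemma bface_bface i j c w : (i < j <= (size w).+2)%N ->
  bface i (bface j c) w = bface j.-1 (bface i c) w.
Proof.
elim: i j c w => [|i IH] j c w; first by case: j => [|[|j]] //; rewrite !bE.
case: j => [|[|j]] //.
case: i IH => [|i] IH.
  case: w => [|b w] ij; first by case: j ij => // _; rewrite !bE.
  case: j ij => [|j] ij; case: b ij => ij; rewrite !bE //.
  - by rewrite addrA.
  - by rewrite -wfaceD; apply: eq_wface => v _; rewrite bE.
  - by apply: eq_wface => v _; rewrite bE.
case: w => [|b w]; first by move=> /=; lia.
case: j => [|j] // ij; rewrite !bE; exact: (IH j.+2 (fun u => c (b :: u)) w).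
Qed.

Lemma bface_bdegen_lt i j c w : (i < j <= size w)%N ->
  bface i (bdegen j c) w = bdegen j.-1 (bface i c) w.
Proof.
elim: i j c w => [|i IH] [|j] c w //.
case: i IH => [|i] IH; case: w => [|b w]; rewrite ?andbF // => ij.
  by case: j ij => // j ij; case: b ij => ij; rewrite !bE -?wdegenD; apply: eq_wdegen => v _; rewrite bE.
case: j ij => // j ij; rewrite !bE; exact: (IH j.+1 (fun u => c (b :: u)) w).
Qed.

Lemma bface_bdegen_eq j c w : (j <= size w)%N ->
  bface j (bdegen j c) w = c w /\ bface j.+1 (bdegen j c) w = c w.
Proof.
elim: j c w => [|j IH] c w jw.
  by case: w jw => [|[] w] _; rewrite !bE //= ?addr0 ?add0r.
case: w jw => // b w jw; have [] := IH (fun u => c (b :: u)) w jw.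
case: j jw {IH} => [|j] jw; rewrite !bE // => h1 h2; split=> //.
by case: b h1 h2 {jw}; rewrite !bE //= ?add0r ?addr0.
Qed.

Lemma bface_bdegen_gt i j c w : (j.+1 < i <= (size w).+1)%N ->
  bface i (bdegen j c) w = bdegen j (bface i.-1 c) w.
Proof.
elim: j i c w => [|j IH] [|[|i]] c [|b w] //; rewrite ?andbF ?ltn0 // => ij.
  by case: b ij; rewrite !bE //; case: i => [|i] _; rewrite ?wface0.
by case: i ij => // i ij; rewrite !bE; exact: (IH i.+2 (fun u => c (b :: u)) w).
Qed.

Lemma bdegen_bdegen i j c w : (i <= j)%N -> (j.+1 < size w)%N ->
  bdegen i (bdegen j c) w = bdegen j.+1 (bdegen i c) w.
Proof.
elim: i j c w => [|i IH] j c [|b w] //= ij jw; rewrite !bE //.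
  case: b => /=; last by apply: eq_wdegen => v _; rewrite bE.
  by rewrite -[LHS](wdegen0 false j w); apply: eq_wdegen => v _; rewrite bE.
by case: j ij jw => // j ij jw; exact: (IH j (fun u => c (b :: u)) w).
Qed.

Section Cochains.
Implicit Types n r : nat.

Definition words n := {ffun n.-tuple bool -> ('F_2)^o}.

Definition wcoef n (a : words n) (w : seq bool) : 'F_2 :=
  if insub w is Some t then a t else 0.

Lemma wcoef_tuple n (a : words n) (t : n.-tuple bool) : wcoef a t = a t.
Proof. by rewrite /wcoef valK. Qed.

Lemma wcoef_ffun n (c : seq bool -> 'F_2) w :
  size w = n -> wcoef ([ffun t : n.-tuple bool => c t] : words n) w = c w.
Proof. by move=> sw; rewrite /wcoef insubT ?sw // => e; rewrite ffunE. Qed.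

Lemma wcoefP n (a : words n) k (b : words n) :
  wcoef (k *: a + b) =1 fun w => k * wcoef a w + wcoef b w.
Proof.
by move=> w; rewrite /wcoef; case: insub => [t|]; rewrite ?ffunE // mulr0 addr0.
Qed.

Lemma eq_words n (a b : words n) :
  (forall w, size w = n -> wcoef a w = wcoef b w) -> a = b.
Proof.
by move=> ab; apply/ffunP => t; rewrite -!wcoef_tuple ab // size_tuple.
Qed.

Definition words_face n r (a : words n.+1) : words n :=
  [ffun t : n.-tuple bool => bface r (wcoef a) t].

Definition words_degen n r (a : words n) : words n.+1 :=
  [ffun t : n.+1.-tuple bool => bdegen r (wcoef a) t].

Fact words_face_linear n r : linear (@words_face n r).
Proof.
move=> k a b; apply/ffunP => t; rewrite !ffunE.
transitivity (k * bface r (wcoef a) t + bface r (wcoef b) t) => //.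
rewrite -wfaceZ -wfaceD.
by apply: eq_wface => v _; rewrite wcoefP.
Qed.

Fact words_degen_linear n r : linear (@words_degen n r).
Proof.
move=> k a b; apply/ffunP => t; rewrite !ffunE.
transitivity (k * bdegen r (wcoef a) t + bdegen r (wcoef b) t) => //.
rewrite -wdegenZ -wdegenD.
by apply: eq_wdegen => v _; rewrite wcoefP.
Qed.

HB.instance Definition _ n r := GRing.isLinear.Build 'F_2 (words n.+1) (words n)
  *:%R (@words_face n r) (@words_face_linear n r).

HB.instance Definition _ n r := GRing.isLinear.Build 'F_2 (words n) (words n.+1)
  *:%R (@words_degen n r) (@words_degen_linear n r).

Lemma wcoef_face n r (a : words n.+1) w :
  size w = n -> wcoef (words_face r a) w = bface r (wcoef a) w.
Proof. exact: wcoef_ffun. Qed.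

Lemma wcoef_degen n r (a : words n) w :
  size w = n.+1 -> wcoef (words_degen r a) w = bdegen r (wcoef a) w.
Proof. exact: wcoef_ffun. Qed.

Fact words_identities : simplicial_identities
  (X := words) (fun n r => @words_face n r) (fun n r => @words_degen n r).
Proof.
split=> [n i j a ij | n i j a ij | n j a jn | n i j a ij | n i j a ij].
- apply: eq_words => w sw; rewrite !wcoef_face //.
  rewrite (eq_wface (c' := bface j (wcoef a))); last first.
    by move=> v sv; rewrite wcoef_face ?sv ?sw.
  rewrite bface_bface ?sw //; apply: eq_wface => v sv.
  by rewrite wcoef_face ?sv ?sw.
- apply: eq_words => w sw; rewrite wcoef_face // wcoef_degen //.
  rewrite (eq_wface (c' := bdegen j (wcoef a))); last first.
    by move=> v sv; rewrite wcoef_degen ?sv ?sw.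
  rewrite bface_bdegen_lt ?sw //; apply: eq_wdegen => v.
  by rewrite sw => - [sv]; rewrite wcoef_face.
- split; apply: eq_words => w sw; rewrite wcoef_face //;
    rewrite (eq_wface (c' := bdegen j (wcoef a)));
    do ?[by move=> v sv; rewrite wcoef_degen ?sv ?sw];
    by have [] := @bface_bdegen_eq j (wcoef a) w; rewrite ?sw.
- apply: eq_words => w sw; rewrite wcoef_face // wcoef_degen //.
  rewrite (eq_wface (c' := bdegen j (wcoef a))); last first.
    by move=> v sv; rewrite wcoef_degen ?sv ?sw.
  rewrite bface_bdegen_gt ?sw //; apply: eq_wdegen => v.
  by rewrite sw => - [sv]; rewrite wcoef_face.
- apply: eq_words => w sw; rewrite !wcoef_degen //.
  rewrite (eq_wdegen (c' := bdegen j (wcoef a))); last first.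
    by move=> v; rewrite sw => - [sv]; rewrite wcoef_degen.
  case/andP: ij => ij jn; rewrite bdegen_bdegen ?sw //.
  by apply: eq_wdegen => v; rewrite sw => - [sv]; rewrite wcoef_degen.
Qed.

(* The direct sum of the K(F_2, q) for all q: a word of length n with q letters
   [true] is a surjection [n] -> [q]. *)
Definition sphere : simplVect := @SimplVect (fun n => words n : lmodType 'F_2)
  (fun n r => @words_face n r) (fun n r => @words_degen n r) words_identities.

Definition fundclass q : sphere q :=
  ([ffun t : q.-tuple bool => (all id t)%:R] : words q).

Lemma wcoef_fundclass q w : size w = q -> wcoef (fundclass q) w = (all id w)%:R.
Proof. exact: (wcoef_ffun (fun w => (all id w)%:R)). Qed.

Lemma bface_all r w : bface r (fun v => (all id v)%:R) w = 0.
Proof.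
elim: r w => [|[|r] IH] [|b w]; rewrite ?bE //.
  by case: b; rewrite bE //= addr0.
case: b; first exact: IH.
by rewrite -[RHS](wface0 false bmul r.+1 w).
Qed.

Lemma fundclass_norm_cycle q : is_norm_cycle (fundclass q).
Proof.
case: q => [|q] r rq; first by [].
apply: eq_words => w sw; rewrite wcoef_face //.
rewrite (eq_wface (c' := fun v => (all id v)%:R)) ?bface_all => [|v sv].
  by rewrite /wcoef; case: insub => [t|]; rewrite ?ffunE.
by rewrite wcoef_fundclass ?sv ?sw.
Qed.

End Cochains.

Section Act.
Variables (X : simplVect) (p : nat) (z : X p).
Implicit Types (x : seq bool) (o n r t : nat).

(* The degeneracy of z along the surjection which is constant on the steps of x
   marked [false], those steps being numbered from o; it is 0 unless the
   surjection is onto {0, ..., p}. *)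
Fixpoint act x o n : X n :=
  match x with
  | [::] => regrade n z
  | true :: y => act y o.+1 n
  | false :: y => if n is m.+1 then degen X m o (act y o m) else 0
  end.

Lemma regrade_neq n : n != p -> regrade n z = 0.
Proof. by move=> /eqP np; rewrite /regrade; case: eqP => // e; case: np. Qed.

(** This lets [sphere] hold all weights at once: words of the wrong weight contribute nothing, and
    no type has to record the weight. *)
Lemma act_neq x o n : (o + size x)%N = n -> (o + count id x)%N != p -> act x o n = 0.
Proof.
elim: x o n => [|[] x IH] o n /= on op.
- by rewrite regrade_neq // -on.
- by apply: IH; rewrite ?addSnnS // addSn -addnS.
- by case: n on => // n on; rewrite add0n in op; rewrite IH ?linear0 //; lia.
Qed.

(** All degeneracies in [act z x o] have index at least o, so a face below o passes them with its
    own index unchanged and lands on z. *)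
Lemma face_act_low x o n r : (o + size x)%N = n.+1 -> (r < o)%N ->
  ((r <= p)%N -> dface r z = 0) -> face X n r (act x o n.+1) = 0.
Proof.
have [_ X2 _ _ _] := sv_identities X.
move=> + + zr; elim: x o n => [|[] x IH] o n /= on ro.
- rewrite addn0 in on; case: (eqVneq n.+1 p) => [e|/regrade_neq->]; last exact: linear0.
  by case: p / e z zr => y yr; rewrite regrade_id; apply: yr; lia.
- by apply: (IH o.+1); lia.
- case: n on => [|n] on; first by lia.
  by rewrite X2 ?IH ?linear0 //; lia.
Qed.

Lemma face_act o x n t : (o + size x)%N = n.+1 -> (0 < t <= size x)%N ->
  normalized z ->
  face X n (o + t)%N (act x o n.+1) = oapp (fun y => act y o n) 0 (bmerge t x).
Proof.
have [_ X2 X3 X4 _] := sv_identities X.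
move=> + + zN; have zr r : (0 < r)%N -> (r <= p)%N -> dface r z = 0.
  by move=> r0 rp; apply: zN; rewrite r0 rp.
elim: x o n t => [|b x IH] o n [|[|t]] // on tx.
  (* One formula for every merge at the first position: two letters t, or a single final t, give
     zero, and a unit on either side is absorbed. *)
  have -> : bmerge 1 (b :: x) = if b && head true x then None
      else Some (if x is _ :: v then b || head true x :: v else [::]).
    by case: b {IH on tx}; case: x => [|[] x].
  case: b on tx => /= on _; last first.
    rewrite addn1; have [|_ ->] /= := X3 n o (act x o n); first by lia.
    by case: x {IH on}.
  case: x {IH} on => [|[] x] /= on.
  - case: (eqVneq n.+1 p) => [e|/regrade_neq->]; last exact: linear0.
    by case: p / e z zN {zr} => y yN; rewrite regrade_id; apply: yN; lia.
  - apply: face_act_low; rewrite ?addn1 //; first by lia.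
    by apply: zr.
  - rewrite addn1; have [|-> _] /= := X3 n o.+1 (act x o.+1 n); first by lia.
    by [].
rewrite wmergeE; case: b on tx => /= on tx.
  rewrite -addSnnS IH //; first by case: wmerge.
  by lia.
case: n on => [|n] on; first by lia.
rewrite X4; last by lia.
rewrite addnS /= IH //; [|by lia].
by case: wmerge => //=; rewrite linear0.
Qed.

Lemma face0_act x n : size x = n.+1 -> is_norm_cycle z ->
  face X n 0 (act x 0 n.+1) = oapp (fun y => act y 0 n) 0 (bmerge 0 x).
Proof.
have [_ _ X3 _ _] := sv_identities X.
case: x => [|[] x] //= sx zZ; first by rewrite (face_act_low (o := 1%N)) //; apply: zZ.
by have [] := X3 n 0%N (act x 0 n).
Qed.

Lemma act_insert x o n t : (o + size x)%N = n -> (t <= size x)%N ->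
  act (binsert t x) o n.+1 = degen X n (o + t)%N (act x o n).
Proof.
have [_ _ _ _ X5] := sv_identities X.
elim: x o n t => [|b x IH] o n [|t] //=; rewrite ?addn0 // => on tx.
case: b => /=; first by rewrite IH ?addSnnS.
case: n on => [|n] on; first by lia.
by rewrite IH; [rewrite X5 ?addnS //; lia|lia|].
Qed.

End Act.

(** Starting from o + 1, all degeneracies have positive index; d_0 passes them, lowers each index by
    one, and reaches y, which need not be a cycle. *)
Lemma face0_act_shift (X : simplVect) p (y : X p.+1) x o n : (o + size x)%N = n ->
  face X n 0 (act y x o.+1 n.+1) = act (face X p 0 y) x o n.
Proof.
have [_ X2 _ _ _] := sv_identities X.
elim: x o n => [|[] x IH] o n /= on.
- case: (eqVneq n p) => [->|np]; first by rewrite !regrade_id.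
  by rewrite !regrade_neq ?linear0.
- by apply: IH; lia.
- case: n on => [|n] on; first by lia.
  by rewrite X2 ?IH //; lia.
Qed.

Lemma actD (X : simplVect) p (y z : X p) x o n :
  act (y + z) x o n = act y x o n + act z x o n.
Proof.
elim: x o n => [|[] x IH] o n /=; rewrite ?linearD ?IH //.
by case: n => [|n]; rewrite ?addr0 ?IH ?linearD.
Qed.

Section SphereMap.
Variables (X : simplVect) (q : nat) (z : X q).

Definition cell_map n (a : sphere n) : X n :=
  wsum n (fun x => wcoef a x *: act z x 0 n).

Fact cell_map_linear n : linear (@cell_map n).
Proof.
move=> k a b; rewrite /cell_map wsumZ -wsumD.
by apply: eq_wsum => w _; rewrite wcoefP scalerDl scalerA.
Qed.

HB.instance Definition _ n := GRing.isLinear.Build 'F_2 (sphere n) (X n)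
  *:%R (@cell_map n) (@cell_map_linear n).

Hypothesis zZ : is_norm_cycle z.

Fact cell_map_face n r (a : sphere n.+1) : (r <= n.+1)%N ->
  cell_map (face sphere n r a) = face X n r (cell_map a).
Proof.
move=> rn; rewrite /cell_map raddf_wsum.
have -> : wsum n (fun x => wcoef (face sphere n r a) x *: act z x 0 n) =
    wsum n (fun x => bface r (wcoef a) x *: act z x 0 n).
  by apply: eq_wsum => w sw; rewrite wcoef_face.
rewrite wsum_wface //; apply: eq_wsum => w sw; rewrite /= linearZ /=; congr (_ *: _).
case: r rn => [|r] rn; first by rewrite face0_act.
rewrite -[r.+1]add0n face_act ?sw //.
by move=> r' /andP[_ ?]; apply: zZ.
Qed.

Fact cell_map_degen n r (a : sphere n) : (r <= n)%N ->
  cell_map (degen sphere n r a) = degen X n r (cell_map a).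
Proof.
move=> rn; rewrite /cell_map raddf_wsum.
have -> : wsum n.+1 (fun x => wcoef (degen sphere n r a) x *: act z x 0 n.+1) =
    wsum n.+1 (fun x => bdegen r (wcoef a) x *: act z x 0 n.+1).
  by apply: eq_wsum => w sw; rewrite wcoef_degen.
rewrite wsum_wdegen //; apply: eq_wsum => w sw; rewrite /= linearZ /=.
by rewrite act_insert ?sw.
Qed.

(** The classifying map K(F_2, q) -> X of the cycle z, extended by zero to the other weights. *)
Definition cell : simplMap sphere X :=
  @SimplMap sphere X (fun n => @cell_map n) cell_map_face cell_map_degen.

Lemma cell_fundclass : cell q (fundclass q) = z.
Proof.
rewrite /= /cell_map.
have -> : wsum q (fun x => wcoef (fundclass q) x *: act z x 0 q) =
    wsum q (fun x => (all id x)%:R *: act z x 0 q).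
  by apply: eq_wsum => w sw; rewrite wcoef_fundclass.
suff E n o : wsum n (fun x => (all id x)%:R *: act z x o q) = z by exact: E.
elim: n o => [|n IH] o /=; first by rewrite scale1r regrade_id.
rewrite big_bool /= IH -[RHS]addr0; congr (_ + _).
rewrite -[RHS](wsum0 bool (X q) n); apply: eq_wsum => w _.
by rewrite scale0r.
Qed.

End SphereMap.

(** * Words of pairs and products in a simplicial algebra *)

(* A word of pairs of bits is a pair of surjections with the same source; a letter
   tells which of the two jump at a step, so D = EN in the exterior algebra. *)
Notation letter := (bool * bool)%type.
Notation lone := (false, false).
Notation lE := (true, false).
Notation lN := (false, true).
Notation lD := (true, true).
Notation lwords := (seq letter).

Definition pmul (x y : letter) : option letter :=
  if bmul x.1 y.1 is Some a then
    if bmul x.2 y.2 is Some b then Some (a, b) else None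
  else None.

Notation pface := (wface lone pmul).
Notation pmerge := (wmerge lone pmul).

Definition lswap (l : letter) : letter := (l.2, l.1).

Lemma lswapK : involutive lswap. Proof. by case. Qed.

Lemma sum_prod (V : zmodType) (I J : finType) (F : I * J -> V) :
  \sum_p F p = \sum_i \sum_j F (i, j).
Proof. by rewrite pair_bigA; apply: eq_bigr => - []. Qed.

Lemma sum_letter (V : zmodType) (F : letter -> V) :
  \sum_l F l = F lD + F lE + F lN + F lone.
Proof. by rewrite sum_prod !big_bool /= addrA. Qed.

Lemma pface1E (c : lwords -> 'F_2) l v : pface 1 c (l :: v) =
  if l.1 then
    if l.2 then c [:: lD, lone & v] + c [:: lE, lN & v]
                + c [:: lN, lE & v] + c [:: lone, lD & v]
    else c [:: lE, lone & v] + c [:: lone, lE & v]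
  else if l.2 then c [:: lN, lone & v] + c [:: lone, lN & v]
  else c [:: lone, lone & v].
Proof.
rewrite wface1_cons big_mkcond sum_prod !sum_letter /=.
by case: l => [[] []] /=; rewrite ?add0r ?addr0 ?addrA.
Qed.

Definition pE := (wface0E, wfaceS_nil, pface1E, wfaceSS_cons).

Lemma pface_prod r (a b : seq bool -> 'F_2) (w : lwords) :
  pface r (fun u => a (unzip1 u) * b (unzip2 u)) w =
  bface r a (unzip1 w) * bface r b (unzip2 w).
Proof.
elim: r a b w => [|[|r] IH] a b [|[x y] w] /=; rewrite !pE //=.
- by case: x y => [] []; rewrite /= ?bE ?mulrDl ?mulrDr ?addrA.
- exact: (IH (fun u => a (x :: u)) (fun u => b (y :: u))).
Qed.

Lemma pmergeP r (w : lwords) :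
  if pmerge r w is Some u then
    bmerge r (unzip1 w) = Some (unzip1 u) /\ bmerge r (unzip2 w) = Some (unzip2 u)
  else bmerge r (unzip1 w) = None \/ bmerge r (unzip2 w) = None.
Proof.
elim: r w => [|[|r] IH] [|[x y] w]; rewrite ?wmergeE /=; try by left.
- by case: x; case: y; rewrite ?wmergeE /=; auto.
- case: w => [|[x' y'] w]; rewrite !wmergeE /=; first by case: x; case: y => /=; auto.
  by case: x; case: x'; case: y; case: y' => /=; auto.
- have := IH w; case: (pmerge r.+1 w) => [u|] /=.
    by case=> -> ->.
  by case=> ->; auto.
Qed.

Section Psi.
Variables (R : simplAlg) (p p' : nat).
Implicit Types (x : R p) (y : R p') (c : lwords -> 'F_2).

Definition pterm x y n (w : lwords) : R n :=
  amul (act x (unzip1 w) 0 n) (act y (unzip2 w) 0 n).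

(** Evaluation at (x, y), followed by multiplication, of the combination of words with coefficients
    c. It makes sense for x and y that are not cycles, as the boundary formulas require. *)
Definition Psi x y n c : R n := wsum n (fun w => c w *: pterm x y n w).

Lemma eq_Psi x y n c c' :
  (forall w, size w = n -> count id (unzip1 w) = p -> count id (unzip2 w) = p' ->
    c w = c' w) ->
  Psi x y n c = Psi x y n c'.
Proof.
move=> cc'; apply: eq_wsum => w sw.
have [p1|p1] := eqVneq (count id (unzip1 w)) p; last first.
  by rewrite /pterm act_neq ?size_map // linear0l !scaler0.
have [p2|p2] := eqVneq (count id (unzip2 w)) p'; last first.
  by rewrite /pterm [act y _ _ _]act_neq ?size_map // linear0r !scaler0.
by rewrite cc'.
Qed.

Lemma PsiD x y n c c' : Psi x y n (fun w => c w + c' w) = Psi x y n c + Psi x y n c'.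
Proof. by rewrite /Psi -wsumD; apply: eq_wsum => w _; rewrite scalerDl. Qed.

Lemma Psi0 x y n : Psi x y n (fun _ => 0) = 0.
Proof. by rewrite -[RHS](wsum0 letter (R n) n); apply: eq_wsum => w _; rewrite scale0r. Qed.

Lemma PsiDl x x' y n c : Psi (x + x') y n c = Psi x y n c + Psi x' y n c.
Proof.
rewrite /Psi -wsumD; apply: eq_wsum => w _.
by rewrite /pterm actD linearDl scalerDr.
Qed.

Lemma PsiDr x y y' n c : Psi x (y + y') n c = Psi x y n c + Psi x y' n c.
Proof.
rewrite /Psi -wsumD; apply: eq_wsum => w _.
by rewrite /pterm actD linearDr scalerDr.
Qed.

Lemma face_Psi x y n r c : (0 < r <= n.+1)%N -> normalized x -> normalized y ->
  face R n r (Psi x y n.+1 c) = Psi x y n (pface r c).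
Proof.
move=> rn xN yN; rewrite /Psi wsum_wface; last by lia.
rewrite raddf_wsum; apply: eq_wsum => w sw; rewrite /= linearZ /=; congr (_ *: _).
rewrite /pterm face_amul; last by lia.
rewrite -[r]add0n !face_act ?size_map ?sw //= add0n.
have := pmergeP r w; case: (pmerge r w) => [u|] /=; first by case=> -> ->.
by case=> -> /=; rewrite ?linear0l ?linear0r.
Qed.

Lemma face_Psi_cycle x y n r c : (r <= n.+1)%N -> is_norm_cycle x -> is_norm_cycle y ->
  face R n r (Psi x y n.+1 c) = Psi x y n (pface r c).
Proof.
case: r => [|r] rn xZ yZ; last first.
  by apply: face_Psi => // r' /andP[_ ?]; [apply: xZ | apply: yZ].
rewrite /Psi wsum_wface // raddf_wsum.
apply: eq_wsum => w sw; rewrite /= linearZ /=; congr (_ *: _).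
rewrite /pterm face_amul // !face0_act ?size_map //.
have := pmergeP 0 w; case: (pmerge 0 w) => [u|] /=; first by case=> -> ->.
by case=> -> /=; rewrite ?linear0l ?linear0r.
Qed.

Lemma Psi_cons x y n c : Psi x y n.+1 c =
  wsum n (fun w => c (lD :: w) *: pterm x y n.+1 (lD :: w)) +
  wsum n (fun w => c (lE :: w) *: pterm x y n.+1 (lE :: w)) +
  wsum n (fun w => c (lN :: w) *: pterm x y n.+1 (lN :: w)) +
  wsum n (fun w => c (lone :: w) *: pterm x y n.+1 (lone :: w)).
Proof.
by rewrite /Psi /= sum_letter. Qed.

End Psi.

Lemma Psi_swap (R : simplAlg) p p' (x : R p) (y : R p') n c :
  Psi y x n c = Psi x y n (fun w => c (map lswap w)).
Proof.
rewrite /Psi -[LHS](wsum_map _ _ lswapK).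
apply: eq_wsum => w _; congr (_ *: _); rewrite /pterm amulC.
by rewrite /unzip1 /unzip2 -!map_comp.
Qed.

(** The first letter tells which factors begin with a jump and so receive d_0; a factor that does
    not has an outermost s_0, which d_0 cancels. *)
Lemma face0_Psi (R : simplAlg) p p' (x : R p.+1) (y : R p'.+1) n c :
  face R n 0 (Psi x y n.+1 c) =
  Psi (face R p 0 x) (face R p' 0 y) n (fun w => c (lD :: w)) +
  Psi (face R p 0 x) y n (fun w => c (lE :: w)) +
  Psi x (face R p' 0 y) n (fun w => c (lN :: w)) +
  Psi x y n (fun w => c (lone :: w)).
Proof.
have [_ _ X3 _ _] := sv_identities R.
have d0s0 m (z : R m) : face R m 0 (degen R m 0 z) = z by have [] := X3 m 0%N z.
rewrite Psi_cons !linearD !raddf_wsum /=; congr (_ + _ + _ + _);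
  apply: eq_wsum => w sw; rewrite linearZ /=; congr (_ *: _);
  by rewrite /pterm face_amul //= ?face0_act_shift ?size_map ?d0s0.
Qed.

Lemma Psi0l (R : simplAlg) p p' (y : R p') n c : Psi (0 : R p) y n c = 0.
Proof. by rewrite -[RHS](F2_addrr (Psi (0 : R p) y n c)) -PsiDl addr0. Qed.

Lemma Psi0r (R : simplAlg) p p' (x : R p) n c : Psi x (0 : R p') n c = 0.
Proof. by rewrite -[RHS](F2_addrr (Psi x (0 : R p') n c)) -PsiDr addr0. Qed.

Arguments eq_Psi {R p p' x y n c c'} _.

Lemma Psi_sum (R : simplAlg) p p' (x : R p) (y : R p') n m (c : nat -> lwords -> 'F_2) :
  Psi x y n (fun w => \sum_(r < m) c r w) = \sum_(r < m) Psi x y n (c r).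
Proof.
rewrite /Psi -(wsum_sum _ xpredT n (fun (r : 'I_m) w => c r w *: pterm x y n w)).
by apply: eq_wsum => w _; rewrite scaler_suml.
Qed.

(** * Stair words, their faces and the normalized differential *)

Section StairWords.
Implicit Types (c e f : lwords -> 'F_2) (u v w : lwords) (l : letter).

Fixpoint isEN w : bool :=
  if w is l :: v then ((l == lE) || (l == lN)) && isEN v else true.

(* The words D^k E {E,N}^*, which encode V(q, q - k) (see [delta_Psi]). *)
Fixpoint stair k w : bool :=
  match k, w with
  | _, [::] => false
  | 0, l :: u => (l == lE) && isEN u
  | k'.+1, l :: u => (l == lD) && stair k' u
  end.

Fixpoint symstair k w : bool :=
  match k, w with
  | 0, _ => isEN w
  | _, [::] => false
  | k'.+1, l :: u => (l == lD) && symstair k' u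
  end.

Definition ind (P : lwords -> bool) w : 'F_2 := (P w)%:R.

Lemma pface_symstair k r w : pface r.+1 (ind (symstair k)) w = 0.
Proof.
elim: k r w => [|k IH] r w.
  elim: r w => [|r IH] [|l w]; rewrite ?pE //.
    by case: l => [[] []]; rewrite /ind /= ?(add0r, addr0, addFF).
  case lEN: ((l == lE) || (l == lN)).
    by rewrite -[RHS](IH w); apply: eq_wface => v _; rewrite /ind /= lEN.
  by rewrite -[RHS](wface0 lone pmul r.+1 w); apply: eq_wface => v _; rewrite /ind /= lEN.
case: r w => [|r] [|l w]; rewrite ?pE //.
  by case: l => [[] []]; rewrite /ind /= ?addr0 //; case: k {IH}.
have [->|lD] := eqVneq l lD; first exact: IH.
rewrite -[RHS](wface0 lone pmul r.+1 w); apply: eq_wface => v _.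
by rewrite /ind /= (negPf lD).
Qed.

(** The forced E can merge with a following N into D^(k+1) u, and no word offers the mirror merge NE
    to cancel it. Merges further right cancel as in [pface_symstair]; those further left involve D
    and vanish. *)
Lemma pface_stair k r w :
  pface r.+1 (ind (stair k)) w = if r == k then ind (symstair k.+1) w else 0.
Proof.
elim: k r w => [|k IH] [|r] [|l w]; rewrite ?pE //=.
- by case: l => [[] []]; rewrite /ind /= ?addr0 ?add0r.
- have [->|lE] := eqVneq l lE; first exact: (pface_symstair 0).
  rewrite -[RHS](wface0 lone pmul r.+1 w); apply: eq_wface => v _.
  by rewrite /ind /= (negPf lE).
- by case: l => [[] []]; rewrite /ind /= ?addr0 //; case: k {IH}.
- by rewrite /ind /= if_same.
- have [->|lD] := eqVneq l lD; first exact: IH.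
  have -> : ind (symstair k.+2) (l :: w) = 0 by rewrite /ind /= (negPf lD).
  rewrite if_same -[RHS](wface0 lone pmul r.+1 w).
  by apply: eq_wface => v _; rewrite /ind /= (negPf lD).
Qed.

Lemma isEN_swap w : isEN (map lswap w) = isEN w.
Proof. by elim: w => //= l w ->; case: l => [[] []]. Qed.

(** The length condition excludes D^k, which lies in [symstair k] and is its own mirror image but
    contains no E. *)
Lemma stair_swap k w : size w != k ->
  ind (stair k) w + ind (stair k) (map lswap w) = ind (symstair k) w.
Proof.
elim: k w => [|k IH] [|l w] // wk; rewrite /ind /=.
- by rewrite isEN_swap; case: l {wk} => [[] []] /=; rewrite ?(addr0, add0r).
- by rewrite addr0.
- have [->|lD] := eqVneq l lD; first exact: (IH w).
  rewrite (_ : lswap l == _ = false) ?addr0 //.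
  by case: l lD {wk} => [[] []].
Qed.

(* The differential of the normalized bar complex of the exterior algebra on E
   and N, acting on cochains: its only nonzero products are EN = NE = D. *)
Fixpoint bdN c w : 'F_2 :=
  if w is l :: v then
    bdN (fun u => c (l :: u)) v +
    (if l == lD then c [:: lE, lN & v] + c [:: lN, lE & v] else 0)
  else 0.

Lemma eq_bdN c c' w :
  (forall v, size v = (size w).+1 -> count id (unzip1 v) = count id (unzip1 w) ->
     count id (unzip2 v) = count id (unzip2 w) -> (lone \notin w -> lone \notin v) ->
     c v = c' v) ->
  bdN c w = bdN c' w.
Proof.
elim: w c c' => //= l w IH c c' cc'; congr (_ + _).
  apply: IH => v sv v1 v2 vn; apply: cc'; rewrite /= ?sv ?v1 ?v2 //.
  by rewrite !in_cons !negb_or => /andP[-> /vn].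
by case: eqP cc' => // -> cc'; congr (_ + _); apply: cc'.
Qed.

Lemma bdND c c' w : bdN (fun v => c v + c' v) w = bdN c w + bdN c' w.
Proof.
elim: w c c' => [|l w IH] c c' /=; first by rewrite addr0.
rewrite IH; case: ifP => _; rewrite ?addr0 //.
by rewrite [RHS]addrACA; congr (_ + _); rewrite addrACA.
Qed.

Lemma bdN0 w : bdN (fun _ => 0) w = 0.
Proof. by elim: w => //= l w ->; rewrite addr0 add0r if_same. Qed.

Lemma bdN_swap c w : bdN (fun u => c (map lswap u)) w = bdN c (map lswap w).
Proof.
elim: w c => //= l w IH c; congr (_ + _); first exact: (IH (fun u => c (lswap l :: u))).
by case: l => [[] []] //=; rewrite addrC.
Qed.

Lemma bdN_isEN c w : isEN w -> bdN c w = 0.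
Proof.
by elim: w c => //= l w IH c /andP[lEN ?]; rewrite IH // add0r; case: l lEN => [[] []].
Qed.

Lemma bdN_ind_isEN w : bdN (ind isEN) w = 0.
Proof.
elim: w => //= l w IH; case: l => [[] []]; rewrite /ind /= ?addr0 ?addFF ?addr0.
- exact: bdN0.
- exact: IH.
- exact: IH.
- exact: bdN0.
Qed.

Lemma bdN_stair k w : bdN (ind (stair k)) w = ind (symstair k.+1) w.
Proof.
elim: k w => [|k IH] [|l w] //.
  by case: l => [[] []]; rewrite /ind /= ?addr0 ?bdN0 ?add0r //; exact: bdN_ind_isEN.
by case: l => [[] []]; rewrite /ind /= ?addr0 ?bdN0 //; exact: IH.
Qed.

(** A word obtained from w by inserting one unit is sent back to w by exactly the two faces adjacent
    to that unit, so these contributions cancel; the splittings of D into EN and NE remain. *)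
Lemma bar_differential c w : lone \notin w ->
  \sum_(r < (size w).+2) pface r c w = bdN c w.
Proof.
move=> wn; rewrite big_ord_recl pE.
suff -> : \sum_(r < (size w).+1) pface (lift ord0 r) c w = c (lone :: w) + bdN c w.
  by rewrite addrA addFF add0r.
rewrite (eq_bigr (fun r : 'I__ => pface r.+1 c w)) //.
elim: w c wn => [|l w IH] c wn /=.
  by rewrite big_ord_recl big_ord0 !pE.
rewrite big_ord_recl (eq_bigr (fun r : 'I__ => pface r.+1 (fun u => c (l :: u)) w)) //.
move: wn; rewrite in_cons negb_or => /andP[l1 wn]; rewrite IH // !pE.
case: l l1 => [[] []] //= _; rewrite ?addr0 addrACA ?addFF ?add0r //.
by rewrite -(addrA (c _)) (addrC (c _)) addFK addrC -addrA.
Qed.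

End StairWords.

(** * Homology of the normalized words *)

Section Normalized.
Implicit Types (c e f : lwords -> 'F_2) (u v w : lwords) (l : letter).

(* A contraction on the cochains supported on words starting with D. *)
Fixpoint unfoldD c w : 'F_2 :=
  match w with
  | lE :: v => c v
  | lN :: v => unfoldD (fun u => c (lN :: u)) v
  | _ => 0
  end.

Lemma eq_unfoldD c c' w :
  (forall v, size w = (size v).+1 -> (lone \notin w -> lone \notin v) -> c v = c' v) ->
  unfoldD c w = unfoldD c' w.
Proof.
elim: w c c' => // - [[] []] w IH c c' cc' //=; first exact: cc'.
apply: IH => v sv vn; apply: cc'; first by rewrite /= sv.
by rewrite !in_cons.
Qed.

Lemma unfoldD0 w : unfoldD (fun _ => 0) w = 0.
Proof. by elim: w => // - [[] []]. Qed.

Lemma bdN_unfoldD c w : bdN (unfoldD c) w = unfoldD (bdN c) w.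
Proof.
elim: w c => // - [[] []] w IH c /=; rewrite ?addr0.
- by rewrite bdN0 add0r addFF.
- by [].
- by rewrite IH; apply: eq_unfoldD => v _ _ /=; rewrite addr0.
- exact: bdN0.
Qed.

(** Koszulness of the exterior algebra: homology lives only on words in E and N, where length equals
    weight. Induction settles what follows a leading E or N, and [unfoldD] repairs a leading D. *)
Lemma bdN_exact n c :
  (forall w, (size w).+1 = n -> lone \notin w -> bdN c w = 0) ->
  (forall w, size w = n -> isEN w -> c w = 0) ->
  exists e, forall w, size w = n -> lone \notin w -> bdN e w = c w.
Proof.
elim: n c => [|n IH] c cZ cEN.
  by exists (fun _ => 0) => w /size0nil -> _; rewrite cEN.
have [|v vs vEN|x1 x1P] := IH (fun u => c (lE :: u)).
- by move=> w sw wn; have := cZ (lE :: w); rewrite /= addr0; apply; rewrite ?sw.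
- by apply: cEN; rewrite /= ?vs.
have [|v vs vEN|x2 x2P] := IH (fun u => c (lN :: u)).
- by move=> w sw wn; have := cZ (lN :: w); rewrite /= addr0; apply; rewrite ?sw.
- by apply: cEN; rewrite /= ?vs.
(* The defect that the two primitives leave on words starting with D. It is a cycle because c is
   one, so adding [unfoldD c3] behind N does not spoil [x2]. *)
pose c3 u := c (lD :: u) + x1 (lN :: u) + x2 (lE :: u).
have c3Z w : (size w).+1 = n -> lone \notin w -> bdN c3 w = 0.
  move=> sw wn; rewrite !bdND.
  have := cZ (lD :: w); rewrite /= sw in_cons /= => /(_ erefl wn).
  rewrite -x1P //= -x2P //= !addr0 => <-; rewrite addrA.
  by [].
exists (fun w => match w with
  | lE :: v => x1 v
  | lN :: v => x2 v + unfoldD c3 v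
  | _ => 0
  end) => - [|[[] []] w] //= [sw]; rewrite in_cons //= => wn.
- by rewrite bdN0 add0r /c3 addrA -(addrA (c _)) addrCA addFF addr0.
- by rewrite addr0 x1P.
- rewrite addr0 bdND x2P // bdN_unfoldD.
  rewrite (eq_unfoldD (c' := fun _ => 0)) ?unfoldD0 ?addr0 // => v sv vn.
  by apply: c3Z; rewrite -?sv ?vn.
Qed.

Definition top_cocycle n c :=
  forall v, (size v).+1 = n -> lone \notin v -> bdN c v = 0.

Lemma top_cocycle_cons n c l : (l == lE) || (l == lN) -> top_cocycle n.+1 c ->
  top_cocycle n (fun u => c (l :: u)).
Proof.
move=> lEN cZ v sv vn; have := cZ (l :: v); rewrite /= sv => /(_ erefl).
by case: l lEN => [[] []] //= _; rewrite addr0; apply.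
Qed.

Lemma isEN_lone w : isEN w -> lone \notin w.
Proof. by elim: w => //= - [[] []] w IH //= /IH; rewrite in_cons. Qed.

(** In a word with a single D, only that letter splits, so a vanishing boundary there gives EN and
    NE equal coefficients. Neighbours can thus be exchanged, and a top cycle depends only on letter
    counts. *)
Lemma top_cocycle_move n c a u : top_cocycle n c -> isEN u ->
  (size u + a).+1 = n -> c (lN :: nseq a lE ++ u) = c (nseq a lE ++ lN :: u).
Proof.
elim: a n c => [|a IH] [|n] c cZ uEN //= [sn]; rewrite addnS in sn.
have vEN : isEN (nseq a lE ++ u) by elim: (a) => //= b ->.
rewrite -(IH n (fun v => c (lE :: v))) //; last exact: top_cocycle_cons.
apply/esym/addF_eq; have := cZ (lD :: nseq a lE ++ u).
rewrite /= bdN_isEN // add0r; apply; last by rewrite in_cons /= isEN_lone.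
by rewrite size_cat size_nseq addnC -sn.
Qed.

Lemma letter_count w : isEN w ->
  (count id (unzip1 w) + count id (unzip2 w))%N = size w.
Proof. by elim: w => //= - [[] []] w IH //= /IH; lia. Qed.

Lemma count_isEN w : lone \notin w ->
  (count id (unzip1 w) + count id (unzip2 w) <= size w)%N -> isEN w.
Proof.
suff : lone \notin w -> (size w <= count id (unzip1 w) + count id (unzip2 w))%N /\
    ((count id (unzip1 w) + count id (unzip2 w) <= size w)%N -> isEN w).
  by move=> h /h[].
elim: w => //= - [[] []] w IH; rewrite in_cons //= => /IH[h1 h2];
  by split; [lia | move=> h; try apply: h2; lia].
Qed.

Lemma top_cocycle_sorted n c w : top_cocycle n c -> size w = n -> isEN w ->
  c w = c (nseq (count id (unzip1 w)) lE ++ nseq (count id (unzip2 w)) lN).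
Proof.
elim: w n c => [|l w IH] [|n] c cZ //= [sw] /andP[lEN wEN].
rewrite (IH n (fun u => c (l :: u))) //; last exact: top_cocycle_cons.
case: l lEN => [[] []] //= _; rewrite ?add0n //.
have vEN b : isEN (nseq b lN) by elim: b => //= b ->.
rewrite (@top_cocycle_move n.+1) // size_nseq addnC -sw; congr _.+1.
exact: letter_count.
Qed.

Definition biweight q w :=
  (count id (unzip1 w) == q) && (count id (unzip2 w) == q).

Lemma biweight_swap q w : biweight q (map lswap w) = biweight q w.
Proof. by rewrite /biweight /unzip1 /unzip2 -!map_comp andbC. Qed.

Lemma lone_swap w : (lone \in map lswap w) = (lone \in w).
Proof. by elim: w => //= l w IH; rewrite !in_cons IH; case: l => [[] []]. Qed.

Lemma bdN_biweight q c w :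
  bdN (fun u => if biweight q u then c u else 0) w =
  if biweight q w then bdN c w else 0.
Proof.
case: ifP => wq; last rewrite -[RHS](bdN0 w); apply: eq_bdN => v _ v1 v2 _;
  by rewrite /biweight v1 v2 -/(biweight q w) wq.
Qed.

(* Downward induction on k: the normalized complex in biweight (q, q) has homology
   only in length 2q, where every cycle is symmetric. *)
Lemma symmetrization_descent q (c : nat -> lwords -> 'F_2) : (0 < q)%N ->
  (forall k w, (k < q)%N -> (size w + k.+1 = 2 * q)%N -> lone \notin w -> biweight q w ->
    bdN (c k) w = c k.+1 w + c k.+1 (map lswap w)) ->
  forall k, (k <= q)%N -> exists e f, forall w, (size w + k = 2 * q)%N ->
    lone \notin w -> biweight q w ->
    c k w = e w + e (map lswap w) + bdN f w.
Proof.
move=> q0 cE k /subKn <-; move: (q - k)%N (leq_subr k q) => j {k}.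
(* Once [c k] and f + T f have the same boundary, their sum is a cycle, to which the homology
   computation applies. *)
have step k f : (k <= q)%N ->
    (forall w, (size w + k.+1 = 2 * q)%N -> lone \notin w -> biweight q w ->
      bdN (c k) w = bdN (fun u => f u + f (map lswap u)) w) ->
    exists e f, forall w, (size w + k = 2 * q)%N -> lone \notin w -> biweight q w ->
      c k w = e w + e (map lswap w) + bdN f w.
  move=> kq cf; pose g u := c k u + (f u + f (map lswap u)).
  pose g' u := if biweight q u then g u else 0.
  have gZ w : (size w + k.+1 = 2 * q)%N -> lone \notin w -> bdN g' w = 0.
    move=> sw wn; rewrite bdN_biweight; case: ifP => // wq.
    by rewrite bdND cf // addFF.
  have cg w : biweight q w -> c k w = f w + f (map lswap w) + g' w.
    by move=> wq; rewrite /g' wq /g addrC addFK.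
  have g'0 w : biweight q w = false -> g' w = 0 by rewrite /g' => ->.
  move: g' gZ cg g'0 => {g cf} g' gZ cg g'0; case: k kq gZ cg => [|k] kq gZ cg.
    have gtop : top_cocycle (2 * q) g' by move=> v sv; apply: gZ; rewrite addn1.
    (* T changes the first letter of a word in E and N, so the symmetric [g'] is the symmetrization
       of its part on words starting with E. The word is nonempty because 0 < q. *)
    exists (fun w => f w + if head lone w == lE then g' w else 0), (fun _ => 0).
    move=> w; rewrite addn0 => sw wn wq; rewrite bdN0 addr0 cg // addrACA.
    congr (_ + _).
    have wEN : isEN w.
      by apply: count_isEN => //; case/andP: wq => /eqP-> /eqP->; lia.
    have gw : g' w = g' (map lswap w).
      rewrite (top_cocycle_sorted gtop) // [RHS](top_cocycle_sorted gtop) ?size_map ?isEN_swap //.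
      have := biweight_swap q w; rewrite wq => /andP[/eqP-> /eqP->].
      by case/andP: wq => /eqP-> /eqP->.
    case: w wEN sw gw {wn wq} => [|[[] []] w] //= _ sw gw; first by lia.
      by rewrite addr0.
    by rewrite add0r.
  have [|v vq vEN|h hP] := @bdN_exact (2 * q - k.+1) g'.
  - by move=> w sw; apply: gZ; lia.
  - apply: g'0; apply/negP => /andP[/eqP v1 /eqP v2].
    by have := letter_count vEN; lia.
  - by exists f, h => w sw wn wq; rewrite hP ?cg //; lia.
elim: j => [|j IH] jq.
  (* At k = q the condition on boundaries concerns words of length q - 1, too short for weight q. *)
  rewrite subn0; apply: (step _ (fun _ => 0)) => // w sw wn /andP[/eqP w1 _].
  by have := count_size id (unzip1 w); rewrite w1 size_map; lia.
have {IH} [|e [f IH]] := IH; first by lia.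
apply: (step _ f); first by lia.
move=> w sw wn wq; rewrite bdND (bdN_swap f) cE; [|lia|lia|by []|by []].
rewrite (_ : (q - j.+1).+1 = (q - j)%N); last by lia.
rewrite !IH ?size_map ?lone_swap ?biweight_swap //; [|lia|lia].
rewrite (mapK lswapK) addrACA (addrC (e (map _ _))) addFF add0r.
by [].
Qed.

End Normalized.

(** * Degenerate cycles *)

Section DegenerateCycles.
Variable X : simplVect.

Definition face_normalize n k (x : X n.+1) : X n.+1 :=
  x + degen X n k (face X n k x).

Lemma bdryE n (x : X n.+1) : bdry x = \sum_(r < n.+2) face X n r x.
Proof. by []. Qed.

Lemma bdry_bdry n (x : X n.+2) : bdry (bdry x : X n.+1) = 0.
Proof.
have [X1 _ _ _ _] := sv_identities X.
rewrite bdryE bdryE; pose F r s := face X n r (face X n.+1 s x).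
transitivity (\sum_(0 <= r < n.+2) \sum_(0 <= s < n.+3) F r s).
  rewrite big_mkord; apply: eq_bigr => r _; rewrite linear_sum.
  by rewrite big_mkord.
rewrite (eq_big_nat _ _ (F2 := fun r => \sum_(0 <= s < n.+2 | (s <= r)%N) F r s +
    \sum_(0 <= s < n.+2 | (r <= s)%N) F s r)); last first.
  move=> r /andP[_ rn]; rewrite (@big_cat_nat _ _ _ r.+1) //=; last by lia.
  congr (_ + _); first by rewrite (big_nat_widen _ _ n.+2) //; lia.
  rewrite big_add1 /= (big_nat_widenl _ 0) //= !big_mkord.
  by apply: eq_big => [s|s rs]; rewrite ?andbT // /F X1 //; have := ltn_ord s; lia.
rewrite big_split /= (exchange_big_dep_nat xpredT) //= F2_addrr //.
Qed.

(* [degen k] is a homotopy from the identity to [face_normalize k] on the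
   elements whose first k faces vanish. *)
Lemma face_normalize_homotopy n k (x : X n.+1) : (k <= n)%N -> bdry x = 0 ->
  (forall r, (r < k)%N -> face X n r x = 0) ->
  face_normalize k x = x + bdry (degen X n.+1 k x).
Proof.
have [_ X2 X3 X4 _] := sv_identities X.
move=> kn xZ xk; congr (_ + _); rewrite bdryE.
have dk r : (r < n.+3)%N -> face X n.+1 r (degen X n.+1 k x) =
    if (r < k)%N then 0 else if (r <= k.+1)%N then x
    else degen X n k (face X n r.-1 x).
  move=> rn; case: ltnP => [rk|kr]; first by rewrite X2 ?xk ?linear0 //; lia.
  case: leqP => rk; last by rewrite X4 //; lia.
  have [|d0 d1] := X3 _ k x; first by lia.
  by have [->|->] : r = k \/ r = k.+1 by lia.
have -> : degen X n k (face X n k x) =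
    \sum_(k.+1 <= r < n.+2) degen X n k (face X n r x).
  rewrite -linear_sum; congr (degen X n k _).
  apply: F2_addr_eq0; rewrite -big_ltn; last by lia.
  rewrite -[RHS]xZ bdryE -(big_mkord xpredT (fun r => face X n r x)).
  rewrite [RHS](@big_cat_nat _ _ _ k) //=; last by lia.
  rewrite [X in _ = X + _]big_nat_cond [X in _ = X + _]big1 ?add0r // => r.
  by rewrite andbT => /andP[_ /xk].
rewrite -(big_mkord xpredT (fun r => face X n.+1 r (degen X n.+1 k x))).
rewrite [RHS](@big_cat_nat _ _ _ k) //=; last by lia.
rewrite [X in _ = X + _]big_nat_cond [X in _ = X + _]big1 ?add0r; last first.
  by move=> r /andP[/andP[_ rk] _]; rewrite dk ?rk //; lia.
rewrite [RHS]big_ltn; last by lia.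
rewrite [X in _ = _ + X]big_ltn; last by lia.
rewrite !dk ?ltnn ?leqnn ?leqnSn; [|lia|lia].
rewrite ltnNge leqnSn /= addrA F2_addrr add0r.
rewrite [RHS]big_nat_cond [in RHS](eq_bigr (fun r => degen X n k (face X n r.-1 x))).
  by rewrite -big_nat_cond [RHS]big_add1.
move=> r /andP[/andP[kr rn] _]; rewrite dk; last by clear -rn; lia.
have -> : (r < k)%N = false by clear -kr; lia.
by have -> : (r <= k.+1)%N = false by clear -kr; lia.
Qed.

(** Applying [face_normalize] for k = 0, ..., n changes x by boundaries only. Round k kills the
    summand in s_k and keeps the form of those in s_j with j > k, so nothing is left at the end. *)
Lemma degenerate_cycle_boundary n (y : nat -> X n) (x : X n.+1) :
  x = \sum_(j < n.+1) degen X n j (y j) -> bdry x = 0 ->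
  exists u : X n.+2, bdry u = x.
Proof.
have [X1 X2 X3 _ X5] := sv_identities X.
move=> xy xZ.
have step k : (k <= n.+1)%N -> exists u : X n.+2, exists y' : nat -> X n,
    [/\ x + bdry u = \sum_(k <= j < n.+1) degen X n j (y' j)
      & forall r, (r < k)%N -> face X n r (x + bdry u) = 0].
  elim: k => [|k IH] kn.
    exists 0, y; split=> //; rewrite linear0 addr0 xy.
    by rewrite (big_mkord xpredT (fun j => degen X n j (y j))).
  have [|u [y' [xu du]]] := IH; first by lia.
  set x' := x + bdry u in xu du.
  have x'Z : bdry x' = 0.
    by rewrite linearD /= bdry_bdry xZ addr0.
  exists (u + degen X n.+1 k x').
  have E : x + bdry (u + degen X n.+1 k x') = face_normalize k x'.
    by rewrite (face_normalize_homotopy (k := k)) // linearD addrA.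
  clear IH; case: n kn y x xy xZ y' u x' xu du x'Z E => [|n] kn y x xy xZ y' u x' xu du x'Z E.
    (* In degree 0 the coefficients cannot be normalized, but the only summand s_0 y is killed
       outright. *)
    have k0 : k = 0%N by lia.
    subst k; exists (fun _ => 0); rewrite {}E; split; last first.
      move=> [|//] _; rewrite linearD /=.
      by have [-> _] := X3 0%N 0%N (face X 0 0 x') isT; rewrite F2_addrr.
    rewrite big_geq // /face_normalize xu big_nat1.
    have [d0 _] := X3 0%N 0%N (y' 0%N) isT.
    by rewrite d0 F2_addrr.
  exists (fun j => face_normalize k (y' j)); rewrite {}E; split; last first.
    move=> r rk; rewrite linearD /=; have [->|rk'] : r = k \/ (r < k)%N by lia.
      have [|-> _] := X3 n.+1 k (face X n.+1 k x'); first by lia.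
      by rewrite F2_addrr.
    rewrite du // add0r X2; last by clear -rk' kn; lia.
    by rewrite X1 ?du ?linear0 //; clear -rk' kn; lia.
  rewrite /face_normalize xu big_ltn //.
  have [|d0 _] := X3 n.+1 k (y' k); first by lia.
  rewrite !linearD /= d0.
  rewrite addrACA F2_addrr add0r !linear_sum -big_split /=.
  apply: eq_big_nat => j /andP[kj jn].
  rewrite X2; last by clear -kj jn; lia.
  rewrite X5; last by clear -kj jn; lia.
  by case: j kj {jn} => // j _; rewrite linearD.
have [//|u [y' [xu _]]] := step n.+1.
by exists u; apply/esym/F2_addr_eq0; rewrite xu big_geq.
Qed.

End DegenerateCycles.

Section DeltaPsi.
(** * The operations delta_i *)

Implicit Types (x : seq bool) (o r k n : nat).

Fixpoint zeros o x : seq nat :=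
  if x is b :: y then (if b then id else cons o) (zeros o.+1 y) else [::].

Lemma zerosS o x : zeros o.+1 x = map S (zeros o x).
Proof. by elim: x o => //= - [] x IH o; rewrite IH. Qed.

Lemma mem_zeros o x r :
  (r \in zeros o x) = (o <= r < o + size x)%N && ~~ nth true x (r - o).
Proof.
elim: x o => [|b x IH] o /=; first by rewrite in_nil nth_nil andbF.
have IH' : (r \in zeros o.+1 x) = (o < r < o + (size x).+1)%N && ~~ nth true x (r - o.+1).
  by rewrite IH addSnnS.
case: (ltngtP o r) IH' => [or|ro|->] IH'.
- rewrite (_ : r - o = (r - o.+1).+1)%N; last by lia.
  by case: b; rewrite /= ?in_cons ?(gtn_eqF or) IH'.
- by case: b; rewrite /= ?in_cons ?(ltn_eqF ro) IH'.
- by rewrite subnn; case: b; rewrite /= ?in_cons ?IH' ?eqxx ?andbF //=; lia.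
Qed.

Lemma zeros_sorted o x : sorted ltn (zeros o x).
Proof.
elim: x o => //= - [] x IH o //=.
rewrite path_sortedE; last exact: ltn_trans.
by rewrite IH andbT; apply/allP => r; rewrite mem_zeros => /andP[/andP[]].
Qed.

Lemma zeros_bound o x j : (j < size (zeros o x))%N ->
  (o <= nth 0 (zeros o x) j <= j + (o + count id x))%N.
Proof.
elim: x o j => [|[] x IH] o j //=.
  by move=> /IH; lia.
case: j => [|j] /=; first by lia.
by rewrite ltnS => /IH; lia.
Qed.

(** [act] applies the smallest index last and [degens] applies it first: s_o s_j = s_(j+1) s_o moves
    s_o inward and raises the other indices. *)
Lemma degen_degens (X : simplVect) m (z : X m) nu o j : (j <= size nu)%N ->
  (o <= m)%N ->
  (forall t, (t < j)%N -> (o <= nth 0 nu t <= t + m)%N) ->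
  degen X (j + m) o (degens nu j z) = degens (o :: map S nu) j.+1 z.
Proof.
have [_ _ _ _ X5] := sv_identities X.
move=> + om; elim: j => //= j IH jn nuP.
rewrite X5; last exact: nuP.
rewrite IH; [|lia|by move=> t tj; apply: nuP; lia].
by rewrite (nth_map 0%N).
Qed.

Lemma act_degens (X : simplVect) m (z : X m) x o : (o + count id x)%N = m ->
  act z x o (size (zeros o x) + m) = degens (zeros o x) (size (zeros o x)) z.
Proof.
elim: x o => [|[] x IH] o om; first exact: regrade_id.
  by apply: (IH o.+1); rewrite addSnnS.
have -> : zeros o (false :: x) = o :: map S (zeros o x) by rewrite /= zerosS.
rewrite /= add0n in om; rewrite [size _]/= size_map -degen_degens //=; first by rewrite IH.
  by lia.
by move=> t tj; rewrite -[X in (_ + X)%N]om; apply: zeros_bound.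
Qed.

Definition step_ok k r (l : letter) : bool :=
  if (r < k)%N then l == lD else if r == k then l == lE else (l == lE) || (l == lN).

Lemma isEN_nth w : reflect (forall r, (r < size w)%N ->
  (nth lone w r == lE) || (nth lone w r == lN)) (isEN w).
Proof.
elim: w => [|l w IH] /=; first by left.
apply: (iffP andP) => [[lEN /IH h] [|r] //|h]; first exact: h.
by split; [exact: (h 0%N) | apply/IH => r; exact: (h r.+1)].
Qed.

Lemma stairP k w : reflect ((k < size w)%N /\
  forall r, (r < size w)%N -> step_ok k r (nth lone w r)) (stair k w).
Proof.
elim: k w => [|k IH] [|l w] /=; try by right; case.
  apply: (iffP andP) => [[lE /isEN_nth h]|[_ h]].
    by split=> // - [|r] //; exact: h.
  by split; [exact: (h 0%N) | apply/isEN_nth => r; exact: (h r.+1)].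
apply: (iffP andP) => [[lD /IH[kw h]]|[kw h]].
  by split=> // - [|r] //; exact: h.
by split; [exact: (h 0%N) | apply/IH; split=> // r; exact: (h r.+1)].
Qed.

Section DeltaWords.
Variables (q i : nat).
Local Notation N := (q + i)%N.
Implicit Types (p : i.-tuple 'I_N * i.-tuple 'I_N).

(** An index in neither sequence is a common jump D, one in mu is E and one in nu is N; the
    condition mu_1 = q - i puts the E right after D^(q-i). *)
Definition shuffle_word p : N.-tuple letter :=
  [tuple (r \notin p.2, r \notin p.1) | r < N].

Lemma nth_shuffle_word p (r : 'I_N) :
  nth lone (shuffle_word p) r = (r \notin p.2, r \notin p.1).
Proof. by rewrite -tnth_nth tnth_mktuple. Qed.

Lemma ordvals_zeros (t : i.-tuple 'I_N) (x : seq bool) : sorted ltn (ordvals t) ->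
  size x = N -> (forall r : 'I_N, nth true x r = (r \notin t)) ->
  ordvals t = zeros 0 x.
Proof.
move=> st sx xt; apply: (irr_sorted_eq ltn_trans ltnn) => // [|r].
  exact: zeros_sorted.
rewrite mem_zeros add0n subn0 sx; case: ltnP => rN /=; last first.
  by apply/mapP => - [s _ rs]; have := ltn_ord s; rewrite -rs ltnNge rN.
by rewrite (xt (Ordinal rN)) negbK -(mem_map val_inj).
Qed.

Lemma ordvals_shuffle_word p : sorted ltn (ordvals p.1) -> sorted ltn (ordvals p.2) ->
  ordvals p.2 = zeros 0 (unzip1 (shuffle_word p)) /\
  ordvals p.1 = zeros 0 (unzip2 (shuffle_word p)).
Proof.
move=> s1 s2; split; apply: ordvals_zeros => //; do ?by rewrite size_map size_tuple.
all: by move=> r; rewrite (nth_map lone) ?size_tuple // nth_shuffle_word.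
Qed.

Lemma count_zeros o x : (count id x + size (zeros o x))%N = size x.
Proof. by elim: x o => //= - [] x IH o /=; rewrite -(IH o.+1); lia. Qed.

Lemma ordvals_inj (t t' : i.-tuple 'I_N) : ordvals t = ordvals t' -> t = t'.
Proof. by move=> e; apply/val_inj/(inj_map val_inj). Qed.

Lemma Vset_word p : (0 < i <= q)%N -> Vset p.1 p.2 ->
  stair (q - i) (shuffle_word p) && biweight q (shuffle_word p).
Proof.
move=> iq /and5P[s1 s2 dis /eqP un /eqP h].
have [z2 z1] := ordvals_shuffle_word s1 s2.
apply/andP; split.
  apply/stairP; rewrite size_tuple; split=> [|r rN]; first by lia.
  have := nth_shuffle_word p (Ordinal rN) => /= ->.
  have inU : (Ordinal rN \in p.1) || (Ordinal rN \in p.2) = (q - i <= r)%N.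
    by move/setP: un => /(_ (Ordinal rN)); rewrite !inE.
  have dis' : ~~ ((Ordinal rN \in p.1) && (Ordinal rN \in p.2)).
    apply/negP => /andP[r1 r2].
    by move/pred0P: dis => /(_ (Ordinal rN)); rewrite /= r1 r2.
  rewrite /step_ok; case: ltngtP inU => [_|_|e] inU.
  - by move: inU; case: (_ \in _) => //=; case: (_ \in _).
  - by move: inU dis'; case: (_ \in _) => //=; case: (_ \in _).
  - suff r1 : Ordinal rN \in p.1 by move: dis'; rewrite r1 /= => ->.
    rewrite -(mem_map val_inj) /= e -h; apply: mem_nth.
    by rewrite size_map size_tuple; case/andP: iq.
have c1 := count_zeros 0 (unzip1 (shuffle_word p)).
have c2 := count_zeros 0 (unzip2 (shuffle_word p)).
rewrite -z2 !(size_map, size_tuple) in c1; rewrite -z1 !(size_map, size_tuple) in c2.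
by rewrite /biweight; apply/andP; split; apply/eqP; lia.
Qed.

Lemma word_Vset (t : N.-tuple letter) : (0 < i <= q)%N ->
  stair (q - i) t -> biweight q t -> exists2 p, Vset p.1 p.2 & t = shuffle_word p.
Proof.
move=> iq /stairP[_ tP] /andP[/eqP t1 /eqP t2].
have tP' (r : 'I_N) : step_ok (q - i) r (tnth t r).
  by rewrite (tnth_nth lone); apply: tP; rewrite size_tuple.
have sz (a : pred letter) : count a t = q ->
    size [seq r <- enum 'I_N | ~~ a (tnth t r)] == i.
  move=> ta; rewrite size_filter -(count_map (tnth t) (predC a)) map_tnth_enum.
  by have := count_predC a t; rewrite ta size_tuple; lia.
have m1 : size [seq r <- enum 'I_N | ~~ (tnth t r).2] == i.
  by apply: (sz (fun l => l.2)); rewrite -[RHS]t2 count_map.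
have m2 : size [seq r <- enum 'I_N | ~~ (tnth t r).1] == i.
  by apply: (sz (fun l => l.1)); rewrite -[RHS]t1 count_map.
have in1 (r : 'I_N) : (r \in Tuple m1) = ~~ (tnth t r).2.
  by rewrite mem_filter mem_enum andbT.
have in2 (r : 'I_N) : (r \in Tuple m2) = ~~ (tnth t r).1.
  by rewrite mem_filter mem_enum andbT.
exists (Tuple m1, Tuple m2); last first.
  apply: eq_from_tnth => r; rewrite tnth_mktuple in1 in2 !negbK.
  by case: (tnth t r).
have so (P : pred 'I_N) : sorted ltn (map val (filter P (enum 'I_N))).
  apply: (subseq_sorted ltn_trans (s2 := map val (enum 'I_N))).
    by apply: map_subseq; apply: filter_subseq.
  by rewrite val_enum_ord iota_ltn_sorted.
have un (r : 'I_N) : (r \in Tuple m1) || (r \in Tuple m2) = (q - i <= r)%N.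
  rewrite in1 in2; have := tP' r; rewrite /step_ok.
  by case: ltngtP => _; case: (tnth t r) => [[] []].
apply/and5P; split; [exact: so | exact: so | | |].
- apply/pred0P => r /=; rewrite in1 in2; have := tP' r; rewrite /step_ok.
  by case: ltngtP => _; case: (tnth t r) => [[] []].
- by apply/eqP/setP => r; rewrite !inE un.
have kN : (q - i < N)%N by lia.
have k1 : (q - i)%N \in ordvals (Tuple m1).
  rewrite -[(q - i)%N]/(val (Ordinal kN)) (mem_map val_inj) in1.
  have := tP' (Ordinal kN); rewrite /step_ok /= ltnn eqxx.
  by case: (tnth t _) => [[] []].
have : all (fun r => q - i <= r)%N (ordvals (Tuple m1)).
  by apply/allP => _ /mapP[r r1 ->]; rewrite -un r1.
have : sorted ltn (ordvals (Tuple m1)) := so _.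
case: (ordvals (Tuple m1)) k1 => // r s /=; rewrite in_cons => ks rs /andP[kr _].
rewrite eqn_leq kr andbT; case/predU1P: ks => [->//|ks].
by move: rs; rewrite path_sortedE => [/andP[/allP/(_ _ ks) /ltnW]|]; last exact: ltn_trans.
Qed.

End DeltaWords.

Lemma delta_Psi (R : simplAlg) q i (z : R q) : (0 < i <= q)%N ->
  delta i z = Psi z z (i + q) (ind (stair (q - i))).
Proof.
move=> iq; have actE j x : size (zeros 0 x) = j -> count id x = q ->
    degens (zeros 0 x) j z = act z x 0 (j + q).
  by move=> <- xq; rewrite act_degens.
pose P (t : (q + i).-tuple letter) := stair (q - i) t && biweight q t.
transitivity (\sum_(t | P t) pterm z z (i + q) t).
  rewrite /delta (partition_big (@shuffle_word q i) P) => [|p]; last exact: Vset_word.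
  apply: eq_bigr => t /andP[st wt]; have [p0 Vp0 tp0] := word_Vset iq st wt.
  rewrite (big_pred1 p0) => [|p /=]; last first.
    apply/andP/eqP => [[Vp /eqP pt]|->]; last by rewrite tp0 eqxx.
    case/and5P: Vp => s1 s2 _ _ _; case/and5P: Vp0 => s10 s20 _ _ _.
    have [e2 e1] := ordvals_shuffle_word s1 s2.
    have [e20 e10] := ordvals_shuffle_word s10 s20.
    rewrite pt tp0 -e20 -e10 in e1 e2.
    by case: p p0 {s1 s2 s10 s20 pt tp0 e10 e20} e1 e2 => [m n] [m0 n0] /=
      /ordvals_inj-> /ordvals_inj->.
  case/and5P: Vp0 => s1 s2 _ _ _; have [e2 e1] := ordvals_shuffle_word s1 s2.
  have si (u : i.-tuple 'I_(q + i)) : size (ordvals u) = i.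
    by rewrite size_map size_tuple.
  case/andP: wt => /eqP w1 /eqP w2.
  by rewrite /pterm e2 e1 -tp0 !actE // tp0 -?e1 -?e2 si.
rewrite /Psi.
(* Only the length of the words is commuted to q + i, the form used by the index set; the degree i +
   q stays, which avoids a cast. *)
have -> : wsum (i + q) (fun w => ind (stair (q - i)) w *: pterm z z (i + q) w) =
    wsum (q + i) (fun w => ind (stair (q - i)) w *: pterm z z (i + q) w).
  by congr wsum; exact: addnC.
rewrite wsum_tuple big_mkcond; apply: eq_bigr => t _; rewrite /P /ind.
case st: (stair _ _); rewrite /= ?scale0r ?scale1r //.
case: ifP => // /negbT; rewrite /biweight negb_and => /orP[] wq; rewrite /pterm.
  by rewrite act_neq ?linear0l // add0n size_map size_tuple addnC.
by rewrite [X in amul _ X]act_neq ?linear0r // add0n size_map size_tuple addnC.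
Qed.

End DeltaPsi.

Lemma Psi_symstair (R : simplAlg) p p' (x : R p) (y : R p') n k : n != k ->
  Psi x y n (ind (symstair k)) = Psi x y n (ind (stair k)) + Psi y x n (ind (stair k)).
Proof.
move=> nk; rewrite (Psi_swap x y) -PsiD; apply: eq_Psi => w sw _ _.
by rewrite stair_swap ?sw.
Qed.

(** The halves of v_(k+1) + T v_(k+1) take the same value at (x, x) in a commutative ring. *)
Lemma face_Psi_stair (R : simplAlg) p (x : R p) n k r : normalized x -> n != k.+1 ->
  (0 < r <= n.+1)%N -> face R n r (Psi x x n.+1 (ind (stair k))) = 0.
Proof.
move=> xN nk rn; rewrite face_Psi //; case: r rn => // r _.
rewrite (eq_Psi (c' := if r == k then ind (symstair k.+1) else fun _ => 0)) => [|w _ _ _].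
  by case: eqP => _; rewrite ?Psi0 // Psi_symstair // F2_addrr.
by rewrite pface_stair; case: ifP.
Qed.

Lemma norm_cycle_normalized (X : simplVect) q (x : X q) : is_norm_cycle x -> normalized x.
Proof. by move=> xZ r /andP[_ rq]; apply: xZ. Qed.

Lemma delta_norm_cycle (R : simplAlg) q i (z : R q) : (2 <= i <= q)%N ->
  is_norm_cycle z -> is_norm_cycle (delta i z).
Proof.
move=> iq zZ r; rewrite delta_Psi; last by lia.
case: i iq => // i iq rn.
change (face R (i + q) r (Psi z z (i + q).+1 (ind (stair (q - i.+1)))) = 0).
have [r0|r0] := posnP r; last first.
  by apply: face_Psi_stair; [exact: norm_cycle_normalized | lia | rewrite r0].
case: q z zZ iq rn => [|q] z zZ iq rn; first by lia.
rewrite r0 face0_Psi [face R q 0 z](zZ 0%N) // Psi0l Psi0l Psi0r !add0r.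
rewrite (eq_Psi (c' := fun _ => 0)) ?Psi0 // => w _ _ _.
by case: (q.+1 - i.+1)%N.
Qed.

(* On (z, y) with z a cycle and y normalized, the words N D^k {E,N}^* (all of
   {E,N}^* if k = 0) exhibit the polarization of [delta] at (z, d_0 y) as a
   boundary. *)
Definition cross k (w : lwords) : bool :=
  match k, w with
  | 0, _ => isEN w
  | _, l :: v => (l == lN) && symstair k v
  | _, [::] => false
  end.

(** For k > 0 the leading N meets a D and the product is zero. For k = 0 it can meet an E, and the
    words starting with E are present to cancel that merge. *)
Lemma pface_cross k r w : pface r.+1 (ind (cross k)) w = 0.
Proof.
case: k => [|k]; first exact: (pface_symstair 0).
case: r w => [|r] [|l w]; rewrite ?pE //.
  by case: l => [[] []]; rewrite /ind /= ?addr0.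
have [->|lN] := eqVneq l lN; first exact: pface_symstair.
rewrite -[RHS](wface0 lone pmul r.+1 w); apply: eq_wface => v _.
by rewrite /ind /= (negPf lN).
Qed.

Lemma delta_add_boundary (R : simplAlg) q i (z : R q) (y : R q.+1) : (2 <= i <= q)%N ->
  is_norm_cycle z -> normalized y ->
  exists2 x : R (i + q).+1, normalized x &
    dface 0 x = delta i (z + dface 0 y) + delta i z.
Proof.
move=> iq zZ yN; pose k := (q - i)%N; pose n := (i + q)%N.
(* The first summand is the formula for [delta i y]: its words start with D, so d_0 hits both copies
   of y and gives delta of d_0 y. The second yields the mixed terms. *)
exists (Psi y y n.+1 (ind (stair k.+1)) + Psi z y n.+1 (ind (cross k))).
  move=> r rn; rewrite linearD [dface r]/= face_Psi_stair //; last by rewrite /n /k; lia.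
  rewrite face_Psi //; last exact: norm_cycle_normalized.
  rewrite add0r (eq_Psi (c' := fun _ => 0)) ?Psi0 // => w _ _ _.
  by case: r rn => // r _; rewrite pface_cross.
rewrite !delta_Psi; [|by lia|by lia].
rewrite linearD [dface 0]/= face0_Psi -/k.
set b := face R q 0 y.
rewrite [X in _ + X + _ + _](eq_Psi (c' := fun _ => 0)) // Psi0 addr0.
rewrite [X in _ + X + _](eq_Psi (c' := fun _ => 0)) // Psi0 addr0.
rewrite [X in _ + X + _](eq_Psi (c' := fun _ => 0)) // Psi0 addr0.
have -> : face R n 0 (Psi z y n.+1 (ind (cross k))) = Psi z b n (ind (symstair k)).
  rewrite /n; case: q z zZ y yN @k @n @b iq => [|q] z zZ y yN k n b iq; first by lia.
  rewrite face0_Psi [face R q 0 z](zZ 0%N) // !Psi0l !add0r.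
  rewrite [X in _ + X](eq_Psi (c' := fun _ => 0)) ?Psi0 ?addr0; last first.
    by move=> w _ _ _; case: (k).
  by apply: eq_Psi => w _ _ _; rewrite /ind; case: (k).
rewrite Psi_symstair; last by rewrite /n /k; lia.
rewrite PsiDl !PsiDr -/n.
by rewrite [LHS]addrC [RHS]addrC !addrA F2_addrr add0r.
Qed.

(** * Comparison with the Bousfield-Dwyer operations *)

Lemma tensor_ind (K : comNzRingType) (V W : lmodType K) (P : tensor V W -> Prop) :
  (forall v w, P (tens v w)) -> P 0 -> (forall x y, P x -> P y -> P (x + y)) ->
  forall x, P x.
Proof.
by move=> Pt P0 PD x; rewrite (tensE x); elim/big_ind: _ => // *; apply: PD.
Qed.

Section Coefficients.
Variables (n : nat) (w : lwords).

Definition coef_pair (a b : sphere n) : ('F_2)^o :=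
  wcoef a (unzip1 w) * wcoef b (unzip2 w).

Fact coef_pair_bilinear : bilinear_for *:%R *:%R coef_pair.
Proof.
split=> [b k a a' | a k b b']; rewrite /coef_pair wcoefP.
  by rewrite mulrDl -mulrA.
by rewrite mulrDr mulrCA.
Qed.

HB.instance Definition _ := bilinear_isBilinear.Build 'F_2 (sphere n) (sphere n)
  ('F_2)^o *:%R *:%R coef_pair coef_pair_bilinear.

Definition coef : tensor (sphere n) (sphere n) -> ('F_2)^o := tlift coef_pair.

HB.instance Definition _ := GRing.Linear.on coef.

Lemma coef_tens (a b : sphere n) :
  coef (tens a b) = wcoef a (unzip1 w) * wcoef b (unzip2 w).
Proof. exact: tlift_tens. Qed.

End Coefficients.

Lemma coef_swap n w (x : tensor (sphere n) (sphere n)) :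
  coef w (tswap x) = coef (map lswap w) x.
Proof.
move: x; apply: tensor_ind => [a b||x y hx hy].
- rewrite tswap_tens !coef_tens mulrC /unzip1 /unzip2 -!map_comp.
  by congr (_ * _); congr wcoef; apply: eq_map.
- by rewrite !linear0.
- by rewrite !linearD /= hx hy.
Qed.

Lemma coef_face n w r (x : tensor (sphere n.+1) (sphere n.+1)) : size w = n ->
  coef w (tmap (face sphere n r) (face sphere n r) x) = pface r (fun v => coef v x) w.
Proof.
move=> sw; move: x; apply: tensor_ind => [a b||x y hx hy].
- rewrite tmap_tens coef_tens !wcoef_face ?size_map // -pface_prod.
  by apply: eq_wface => v _; rewrite coef_tens.
- rewrite !linear0 -[LHS](wface0 lone pmul r w).
  by apply: eq_wface => v _; rewrite linear0.
- rewrite !linearD /= hx hy -wfaceD.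
  by apply: eq_wface => v _; rewrite linearD.
Qed.

Lemma coef_bdry n w (x : tensor (sphere n.+1) (sphere n.+1)) : size w = n ->
  lone \notin w ->
  coef w (bdry (x : stensor sphere sphere n.+1)) = bdN (fun v => coef v x) w.
Proof.
move=> sw wn; rewrite -bar_differential // sw bdryE linear_sum.
by apply: eq_bigr => r _; rewrite /= coef_face.
Qed.

Section Mult.
Variable R : simplAlg.

Lemma amul_wsuml n m (F : seq bool -> R n) (y : R n) :
  amul (wsum m F) y = wsum m (fun u => amul (F u) y).
Proof. by elim: m F => //= m IH F; rewrite linear_sumlz; apply: eq_bigr => b _. Qed.

Lemma amul_wsumr n m (F : seq bool -> R n) (y : R n) :
  amul y (wsum m F) = wsum m (fun u => amul y (F u)).
Proof. by elim: m F => //= m IH F; rewrite linear_sumr; apply: eq_bigr => b _. Qed.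

Lemma mult_cell q (z : R q) (zZ : is_norm_cycle z) n
    (x : tensor (sphere n) (sphere n)) :
  mult (tmap (cell zZ n) (cell zZ n) x) = Psi z z n (fun w => coef w x).
Proof.
move: x; apply: tensor_ind => [a b||x y hx hy].
- rewrite tmap_tens mult_tens /= /cell_map.
  transitivity (wsum n (fun u => wsum n (fun v =>
    (wcoef a u * wcoef b v) *: amul (act z u 0 n) (act z v 0 n)))).
    rewrite amul_wsuml; apply: eq_wsum => u _; rewrite amul_wsumr.
    by apply: eq_wsum => v _; rewrite linearZl_LR linearZr_LR /= scalerA.
  rewrite -wsum_unzip; apply: eq_wsum => w _.
  by rewrite coef_tens.
- by rewrite !linear0 -[LHS](Psi0 z z n); apply: eq_Psi => w *; rewrite linear0.
- rewrite !linearD /= hx hy -PsiD; apply: eq_Psi => w *; by rewrite linearD.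
Qed.

Lemma mult_swap n (x : tensor (R n) (R n)) : mult (tswap x) = mult x.
Proof.
move: x; apply: tensor_ind => [a b||x y hx hy].
- by rewrite tswap_tens !mult_tens amulC.
- by rewrite !linear0.
- by rewrite !linearD /= hx hy.
Qed.

Lemma mult_bdry n (x : tensor (R n.+1) (R n.+1)) :
  mult (bdry (x : stensor R R n.+1)) = bdry (mult x).
Proof.
rewrite !bdryE linear_sum; apply: eq_bigr => r _ /=.
move: x; apply: tensor_ind => [a b||x y hx hy].
- by rewrite tmap_tens !mult_tens face_amul // -ltnS.
- by rewrite !linear0.
- by rewrite !linearD /= hx hy.
Qed.

End Mult.

(** Each word containing a unit is assigned to the position j of its first unit, where s_j inserts
    one. *)
Lemma unit_letter_split n (c : lwords -> 'F_2) :
  (forall w, size w = n -> lone \notin w -> c w = 0) ->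
  exists f : nat -> lwords -> 'F_2, forall w, size w = n ->
    c w = \sum_(j < n) wdegen lone j (f j) w.
Proof.
elim: n c => [|n IH] c cn.
  by exists (fun _ _ => 0) => w /size0nil ->; rewrite big_ord0 cn.
have IHl l : l != lone -> exists f : nat -> lwords -> 'F_2, forall w, size w = n ->
    c (l :: w) = \sum_(j < n) wdegen lone j (f j) w.
  move=> l1; apply: (IH (fun u => c (l :: u))) => w sw wn; apply: cn; rewrite /= ?sw //.
  by rewrite in_cons eq_sym negb_or l1.
have [fD fDP] := IHl lD isT; have [fE fEP] := IHl lE isT; have [fN fNP] := IHl lN isT.
pose f j w := match j, w with
  | 0, _ => c (lone :: w)
  | j'.+1, lD :: v => fD j' v
  | j'.+1, lE :: v => fE j' v
  | j'.+1, lN :: v => fN j' v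
  | _, _ => 0
  end.
exists f => - [|l w] //= [sw]; rewrite big_ord_recl wdegenE.
rewrite (eq_bigr (fun j : 'I_n => wdegen lone j (fun u => f j.+1 (l :: u)) w)) //.
case: l => [[] []] /=; rewrite ?add0r ?fDP ?fEP ?fNP //.
by rewrite big1 ?addr0 // => j _; apply: wdegen0.
Qed.

Lemma pterm_insert (R : simplAlg) p p' (x : R p) (y : R p') n j w :
  size w = n -> (j <= n)%N ->
  pterm x y n.+1 (winsert lone j w) = degen R n j (pterm x y n w).
Proof.
move=> sw jn; rewrite /pterm degen_amul //.
have e1 : unzip1 (winsert lone j w) = binsert j (unzip1 w).
  by elim: j (w) {sw jn} => [|j IH] [|l v] //=; rewrite IH.
have e2 : unzip2 (winsert lone j w) = binsert j (unzip2 w).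
  by elim: j (w) {sw jn e1} => [|j IH] [|l v] //=; rewrite IH.
by rewrite e1 e2 !act_insert ?size_map ?sw.
Qed.

Lemma Psi_degenerate (R : simplAlg) q (z : R q) n (c : lwords -> 'F_2) :
  (forall w, size w = n.+1 -> lone \notin w -> biweight q w -> c w = 0) ->
  exists y : nat -> R n, Psi z z n.+1 c = \sum_(j < n.+1) degen R n j (y j).
Proof.
move=> cn; pose c' w := if biweight q w then c w else 0.
have [w sw wn|f fP] := @unit_letter_split n.+1 c'.
  by rewrite /c'; case: ifP => // wq; apply: cn.
exists (fun j => Psi z z n (f j)).
rewrite (eq_Psi (c' := c')) => [|w _ w1 w2]; last by rewrite /c' /biweight w1 w2 !eqxx.
rewrite /Psi; under eq_wsum => w sw do rewrite fP // scaler_suml.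
rewrite (wsum_sum _ xpredT); apply: eq_bigr => j _.
rewrite wsum_wdegen -1?ltnS // raddf_wsum; apply: eq_wsum => w sw.
by rewrite /= linearZ /= pterm_insert // -ltnS.
Qed.

(** * Products induced by the higher Eilenberg-MacLane maps *)

Section HigherProducts.
Variables (D : higherEM) (R : simplAlg).

Definition hprod k n i j (a : R i) (b : R j) : R n := mult (hem D R R k i j n (tens a b)).

Lemma hprodDl k n i j (a a' : R i) (b : R j) :
  hprod k n (a + a') b = hprod k n a b + hprod k n a' b.
Proof. by rewrite /hprod linearDl !linearD. Qed.

Lemma hprodDr k n i j (a : R i) (b b' : R j) :
  hprod k n a (b + b') = hprod k n a b + hprod k n a b'.
Proof. by rewrite /hprod linearDr !linearD. Qed.

Lemma hprod0l k n i j (b : R j) : hprod k n (0 : R i) b = 0.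
Proof. by rewrite /hprod linear0l !linear0. Qed.

Lemma hprod0r k n i j (a : R i) : hprod k n a (0 : R j) = 0.
Proof. by rewrite /hprod linear0r !linear0. Qed.

Lemma hprod_bdry k n i j (a : R i) (b : R j) :
  (i + j = k.+1 + n)%N -> (k.+1 <= n)%N -> ~~ ((i == k.+1) && (j == k.+1)) ->
  hprod k.+1 n a b + hprod k.+1 n b a =
  hprod k n (bdry a) b + hprod k n a (bdry b) + bdry (hprod k n.+1 a b).
Proof.
move=> ijn kn /negPf ijk; rewrite /hprod -mult_bdry.
have := hemS D (tens a b : tensor (R i) (R j)) ijn kn.
rewrite /phi ijk addr0 tswap_tens !tmap_tens => /(congr1 (@mult R n)).
by rewrite !linearD /= mult_swap.
Qed.

Lemma ThetaE q i (z : R q) : bdry z = 0 ->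
  Theta i D z = hprod (q - i) (i + q) z z.
Proof. by move=> zZ; rewrite /Theta zZ -/(hprod _ _ _ _) -/(hprod _ _ _ _) hprod0r addr0. Qed.

Lemma Theta_cycle q i (z : R q) : (2 <= i <= q)%N -> bdry z = 0 -> bdry (Theta i D z) = 0.
Proof.
move=> iq zZ; rewrite ThetaE //; case: i iq => // i iq.
change (bdry (hprod (q - i.+1) (i + q).+1 z z) = 0).
have := @hprod_bdry (q - i.+1) (i + q) _ _ z z.
rewrite zZ hprod0l hprod0r !add0r F2_addrr => <- //; first by lia.
  by lia.
by apply/negP => /andP[/eqP]; lia.
Qed.

Lemma Theta_add_boundary q i (z : R q) (y : R q.+1) : (2 <= i <= q)%N -> bdry z = 0 ->
  exists x : R (i + q).+1, bdry x = Theta i D (z + bdry y) + Theta i D z.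
Proof.
move=> iq zZ; set b := bdry y; pose k := (q - i)%N; pose n := (i + q)%N.
have bZ : bdry b = 0.
  by rewrite /b; case: q z zZ y iq {b k n} => [|q] z zZ y iq; [lia | exact: bdry_bdry].
have [u hu] : exists u : R n.+1, hprod k n z b + hprod k n b z = bdry u.
  (* For k > 0 the relation of index k bounds the symmetrized mixed term. That of index 0 involves
     the shuffle map, so for k = 0 the relations of index 1 at (z, y) and (y, z) are added; their
     left sides cancel. *)
  rewrite /n; case ek: k => [|k'].
    exists (hprod 0 (i + q).+1 z y + hprod 0 (i + q).+1 y z).
    have h1 := @hprod_bdry 0 (i + q) _ _ z y; have h2 := @hprod_bdry 0 (i + q) _ _ y z.
    rewrite zZ !(hprod0l, hprod0r, add0r, addr0) in h1 h2.
    apply: F2_addr_eq0; rewrite linearD /= addrACA -h1 -?h2; try by lia.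
    by rewrite [X in _ + X]addrC F2_addrr.
  exists (hprod k' (i + q).+1 z b).
  have := @hprod_bdry k' (i + q) _ _ z b.
  rewrite zZ bZ hprod0l hprod0r !add0r => -> //; rewrite -?ek /k; [lia|lia|].
  by apply/negP => /andP[/eqP]; lia.
(* The relation of index k + 1 at (y, b) leaves a symmetric term, which the relation of index k + 2
   at (y, y) shows to be a boundary. *)
have [v hv] : exists v : R n.+1, hprod k n b b = bdry v.
  exists (hprod k n.+1 y b + hprod k.+1 n.+1 y y).
  have h1 := @hprod_bdry k n _ _ y b; have h2 := @hprod_bdry k.+1 n _ _ y y.
  rewrite -/b bZ hprod0r addr0 in h1; rewrite -/b F2_addrr in h2.
  have e1 := h1 ltac:(lia) ltac:(lia) ltac:(lia).
  have e2 := h2 ltac:(lia) ltac:(lia) ltac:(lia).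
  rewrite linearD /= [hprod k.+1 n b y + _]addrC e1 in e2 *.
  apply: F2_addr_eq0; by rewrite addrA -e2.
exists (u + v); rewrite linearD /= -hu -hv !ThetaE //; last by rewrite linearD /= zZ bZ addr0.
rewrite -/k -/n hprodDl !hprodDr.
by rewrite [RHS]addrC !addrA F2_addrr add0r.
Qed.

Lemma coef_phi_fundclass k n q w : q = k -> n = q -> size w = n ->
  coef w (phi k n (tens (fundclass q) (fundclass q)) : tensor (sphere n) (sphere n)) =
  (all id (unzip1 w))%:R * (all id (unzip2 w))%:R.
Proof.
move=> <- -> sw; rewrite /phi eqxx /= tmap_tens coef_tens /= !regrade_id.
by rewrite !wcoef_fundclass ?size_map.
Qed.

(* In the sphere, D^k(iota, iota) and the stair words satisfy the same recursion. *)
Lemma delta_Theta q i (z : R q) : (2 <= i <= q)%N -> is_norm_cycle z ->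
  exists x : R (i + q).+1, bdry x = delta i z + Theta i D z.
Proof.
move=> iq zZ.
have bz0 : bdry z = 0 by rewrite /bdry big1 // => r _; rewrite zZ // -ltnS.
pose iota := fundclass q.
pose u k n : tensor (sphere n) (sphere n) := hem D sphere sphere k q q n (tens iota iota).
pose c k w := coef w (u k (size w)) + ind (stair k) w.
have bd_iota : bdry iota = 0.
  by rewrite /bdry big1 // => r _; rewrite fundclass_norm_cycle // -ltnS.
have cE k w : (k < q)%N -> (size w + k.+1 = 2 * q)%N -> lone \notin w -> biweight q w ->
    bdN (c k) w = c k.+1 w + c k.+1 (map lswap w).
  move=> kq sw wn wq; rewrite bdND bdN_stair.
  rewrite (eq_bdN (c' := fun v => coef v (u k (size w).+1))); last first.
    by move=> v sv _ _ _; rewrite sv.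
  rewrite -coef_bdry //.
  have qn : (q + q = k.+1 + size w)%N by lia.
  have kw : (k.+1 <= size w)%N by lia.
  have e := hemS D (tens iota iota : tensor (sphere q) (sphere q)) qn kw.
  rewrite tswap_tens !tmap_tens /= bd_iota linear0l linear0r !linear0 !add0r in e.
  have {}e := congr1 (fun x => coef w x) e; rewrite !linearD /= coef_swap in e.
  rewrite /c size_map -/(u k.+1 (size w)).
  have -> : coef w (bdry (u k (size w).+1 : stensor sphere sphere (size w).+1)) =
     coef w (u k.+1 (size w)) + coef (map lswap w) (u k.+1 (size w)) +
     coef w (phi k.+1 (size w) (tens iota iota)).
    by rewrite e addFK.
  rewrite [RHS]addrACA -[LHS]addrA; congr (_ + _).
  (* In the exceptional case k + 1 = q the word is D^q: [phi] and [symstair] each contribute 1, and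
     the stair terms 0. *)
  have [wk|wk] := eqVneq (size w) k.+1; last first.
    rewrite stair_swap // /phi (_ : q == k.+1 = false) ?linear0 ?add0r //.
    by apply/eqP; lia.
  have qk : q = k.+1 by move: sw; rewrite wk; clear; lia.
  have wD : w = nseq (size w) lD.
    case/andP: wq => /eqP w1 /eqP w2.
    have : all id (unzip1 w) by rewrite all_count w1 size_map wk qk.
    have : all id (unzip2 w) by rewrite all_count w2 size_map wk qk.
    by elim: (w) => //= - [[] []] v IH //= v2 v1; rewrite {1}IH.
  rewrite coef_phi_fundclass ?wk // wD wk /unzip1 /unzip2 !map_nseq.
  have allT m : all id (nseq m true) by elim: m.
  have stD m : stair m (nseq m lD) = false by elim: m.
  have syD m : symstair m (nseq m lD) by elim: m.
  by rewrite /ind !allT (stD k.+1) (syD k.+1) mulr1 addr0 addFF.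
have [|e [f efP]] := symmetrization_descent _ cE (leq_subr i q); first by lia.
case: i iq e f efP => // i iq e f efP; pose k := (q - i.+1)%N; pose N := (i + q).+1.
(* The last sum is the full boundary of f, including unit letters; it agrees with [bdN f] only on
   words without them. *)
pose g w := coef w (u k N) + ind (stair k) w + (e w + e (map lswap w)) +
  \sum_(r < N.+2) pface r f w.
have PsiE : Psi z z N g = hprod k N z z + delta i.+1 z + bdry (Psi z z N.+1 f).
  rewrite !PsiD (Psi_sum z z N N.+2 (fun r => pface r f)) -(Psi_swap z z N e) F2_addrr addr0 bdryE.
  rewrite -(mult_cell zZ) -hem_natural; [|by rewrite /N /k; lia|by rewrite /N /k; lia].
  rewrite tmap_tens cell_fundclass delta_Psi; last by lia.
  congr (_ + _ + _); apply: eq_bigr => r _.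
  by rewrite face_Psi_cycle // -ltnS.
have gP w : size w = N -> lone \notin w -> biweight q w -> g w = 0.
  move=> sw wn wq; rewrite /g.
  have -> : \sum_(r < N.+2) pface r f w = bdN f w by rewrite -sw bar_differential.
  have := efP w; rewrite /c sw => -> //; last by rewrite /N; lia.
  by rewrite -addrA; exact: addFF.
have [y gy] := Psi_degenerate z gP.
have tZ : bdry (hprod k N z z) = 0.
  by have := Theta_cycle iq bz0; rewrite ThetaE.
have dZ : bdry (delta i.+1 z) = 0.
  by rewrite /bdry big1 // => r _; apply: delta_norm_cycle => //; rewrite -ltnS.
have gZ : bdry (Psi z z N g) = 0.
  rewrite PsiE linearD /= (linearD (@bdry R N)) /= bdry_bdry tZ addr0 add0r.
  exact: dZ.
have [v hv] := degenerate_cycle_boundary gy gZ.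
exists (v + Psi z z N.+1 f).
by rewrite linearD /= hv PsiE F2_addrK ThetaE // addrC.
Qed.
End HigherProducts.

Lemma repr_hclass (U : zmodType) (Z : U -> Prop) (B : zmodClosed U) (z : cycle_type Z) :
  val (repr (hclass B z)) - val z \in B.
Proof. by apply/hclassP; rewrite /hclass reprK. Qed.

Theorem theorem1p3 (R : simplAlg) (q i : nat) (hi : (2 <= i <= q)%N) :
  exists2 delta_Z : Zn R q -> Zn R (i + q),
    (forall z : Zn R q, val (delta_Z z) = delta i (val z))
  & exists2 delta_pi : homotopy R q -> homotopy R (i + q),
    (forall z : Zn R q, delta_pi (hclass _ z) = hclass _ (delta_Z z))
  & forall D : higherEM,
    exists2 theta : chain_homology R q -> chain_homology R (i + q),
      is_BousfieldDwyer D theta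
    & forall x : homotopy R q,
        homotopy_to_chain (delta_pi x) = theta (homotopy_to_chain x).
Proof.
have deltaZ (z : Zn R q) : `[< is_norm_cycle (delta i (val z)) >].
  by apply/asboolP/delta_norm_cycle => //; apply/asboolP/(valP z).
pose delta_Z (z : Zn R q) : Zn R (i + q) :=
  exist (fun x : R (i + q) => `[< is_norm_cycle x >]) (delta i (val z)) (deltaZ z).
exists delta_Z => //.
exists (fun x => hclass _ (delta_Z (repr x))) => [z|D].
  apply/hclassP => /=; have /asboolP[y yN dy] := repr_hclass (norm_boundary R q) z.
  have /asboolP zZ := valP z; have [x xN dx] := delta_add_boundary hi zZ yN.
  apply/asboolP; exists x => //.
  by rewrite dx dy [val z + _]addrC subrK F2_oppr.
have ThetaZ (z : chain_cycle R q) : `[< bdry (Theta i D (val z)) = 0 >].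
  by apply/asboolP/Theta_cycle => //; apply/asboolP/(valP z).
pose Theta_Z (z : chain_cycle R q) : chain_cycle R (i + q) :=
  exist (fun x : R (i + q) => `[< bdry x = 0 >]) (Theta i D (val z)) (ThetaZ z).
have Theta_class (z z' : chain_cycle R q) : val z - val z' \in chain_boundary R q ->
    hclass (chain_boundary R (i + q)) (Theta_Z z) = hclass _ (Theta_Z z').
  move=> /asboolP[y dy]; apply/hclassP => /=.
  have /asboolP zZ := valP z'; have [x dx] := Theta_add_boundary D y hi zZ.
  by apply/asboolP; exists x; rewrite dx dy [val z' + _]addrC subrK F2_oppr.
exists (fun x => hclass _ (Theta_Z (repr x))) => [z|x].
  by exists (Theta_Z z) => //; apply: Theta_class; apply: repr_hclass.
rewrite homotopy_to_chain_class /homotopy_to_chain; set z := repr x.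
(* The chosen representative of the chain class need not be normalized; it is replaced by z, to
   which [delta_Theta] applies. *)
rewrite (Theta_class _ (chain_cycle_of z)); last exact: repr_hclass.
have /asboolP zZ := valP z; have [y dy] := delta_Theta D hi zZ.
by apply/hclassP/asboolP; exists y; rewrite dy /= F2_oppr.
Qed.
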